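(* Let $d,n,t\in\mathbb{N}$ and let $Y\subseteq\mathbb{T}^d$ be an order $2$ digital $(t,n,d)$-net (in base $2$) of cardinality $N=2^n$. Let $X=\mathcal{R}Y=\{(|2y_1-1|,\dots,|2y_d-1|):(y_1,\dots,y_d)\in Y\}\subseteq[0,1]^d$ be the tent transformed point (multi)set, with $\#X=N$ counted with multiplicity. Then $$ e^{\mathrm{QMC}}(X,H^2_{\mathrm{mix}}([0,1]^d))\le C\,2^t N^{-2}(\log N)^{2d-1}, $$ where $C>0$ depends only on $d$.
   Context: $\mathbb{T}^d$ is identified with $[0,1)^d$. $H^2_{\mathrm{mix}}([0,1]^d)$ is the $d$-fold Hilbert tensor product of $H^2([0,1])=\{f\in L_2([0,1]):f''\in L_2([0,1])\}$ (weak derivative) with norm $\|f\|^2=\|f\|^2_{L_2}+\|f''\|^2_{L_2}$; equivalently the real functions $f$ on $[0,1]^d$ with $\big(\prod_{i\in e}\partial^2/\partial x_i^2\big)f\in L_2([0,1]^d)$ for all $e\subseteq\{1,\dots,d\}$, normed by the square root of the sum of the squared $L_2$-norms of these derivatives (any equivalent norm changes only the constant). For a finite multiset $X\subseteq[0,1]^d$ of $N$ points, $e^{\mathrm{QMC}}(X,H^2_{\mathrm{mix}}([0,1]^d))=\sup_{\|f\|\le1}\big|\frac1N\sum_{\mathbf{x}\in X}f(\mathbf{x})-\int_{[0,1]^d}f(\mathbf{x})\,d\mathbf{x}\big|$. Order $\alpha$ digital nets: let $C_1,\dots,C_d\in\{0,1\}^{\alpha n\times n}$ be matrices over the field $\mathbb{Z}/2\mathbb{Z}$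 with rows $c_{i,1}^\top,\dots,c_{i,\alpha n}^\top$. For $k=\kappa_0+2\kappa_1+\dots+2^{n-1}\kappa_{n-1}\in\{0,\dots,2^n-1\}$ with $\kappa=(\kappa_0,\dots,\kappa_{n-1})^\top$, compute $C_i\kappa=(\kappa^{(i)}_1,\dots,\kappa^{(i)}_{\alpha n})^\top$ over $\mathbb{Z}/2\mathbb{Z}$ and set $y^k_i=\sum_{\ell=1}^{\alpha n}\kappa^{(i)}_\ell 2^{-\ell}$; the digital net is $Y=\{\mathbf{y}^0,\dots,\mathbf{y}^{2^n-1}\}$. It is an order $\alpha$ digital $(t,n,d)$-net if for all choices of integers $0\le\nu_i\le n$ and indices $1\le j_{i,\nu_i}<\dots<j_{i,1}\le\alpha n$ ($i=1,\dots,d$) with $\sum_{i=1}^d\sum_{\ell=1}^{\min\{\alpha,\nu_i\}}j_{i,\ell}\le\alpha n-t$, the row vectors $c_{1,j_{1,\nu_1}},\dots,c_{1,j_{1,1}},\dots,c_{d,j_{d,\nu_d}},\dots,c_{d,j_{d,1}}\in\{0,1\}^n$ are linearly independent over $\mathbb{Z}/2\mathbb{Z}$. Here $\alpha=2$. *)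

(* Defs.v *)
From HB Require Import structures.
From mathcomp Require Import all_boot all_order all_algebra.
From mathcomp Require Import all_classical all_reals all_analysis.
Set Implicit Arguments. Unset Strict Implicit. Unset Printing Implicit Defensive.
Import Order.TTheory GRing.Theory Num.Theory.
Import numFieldNormedType.Exports.
Local Open Scope classical_set_scope.
Local Open Scope ring_scope.

(* Rows are indexed 0-based: row j : 'I_(2*n) is the paper's row j+1. *)
Definition top2 (m : nat) (S : {set 'I_m}) : {set 'I_m} :=
  [set j in S | #|[set k in S | j < k]| < 2]%N.

(* sum_{l <= min(2, nu)} j_l  (paper's 1-based indices) *)
Definition top2_weight (m : nat) (S : {set 'I_m}) : nat :=
  (\sum_(j in top2 S) j.+1)%N.

Definition order2_digital_net (d t n : nat)
    (C : 'I_d -> 'M['F_2]_(2 * n, n)) : Prop :=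
  forall S : 'I_d -> {set 'I_(2 * n)},
    (forall i, #|S i| <= n)%N ->
    (\sum_(i < d) top2_weight (S i) + t <= 2 * n)%N ->
    forall a : 'I_d -> 'I_(2 * n) -> 'F_2,
      \sum_(i < d) \sum_(j in S i) a i j *: row j (C i) = 0 ->
      forall i j, j \in S i -> a i j = 0.

Definition digits (n : nat) (k : nat) : 'cV['F_2]_n :=
  \col_(m < n) (odd (k %/ 2 ^ m))%:R.

Definition net_coord (R : realType) (d n : nat)
    (C : 'I_d -> 'M['F_2]_(2 * n, n)) (k : nat) (i : 'I_d) : R :=
  \sum_(l < 2 * n)
     (((C i *m digits n k) l ord0 != 0 : bool) : nat)%:R / (2 ^+ l.+1).

Definition tent_net_point (R : realType) (d n : nat)
    (C : 'I_d -> 'M['F_2]_(2 * n, n)) (k : 'I_(2 ^ n)) : 'rV[R]_d :=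
  \row_i `|2 * net_coord R C k i - 1|.

Definition set_coord (R : realType) (d : nat) (x : 'rV[R]_d) (i : 'I_d) (u : R)
  : 'rV[R]_d := \row_j (if j == i then u else x ord0 j).

Fixpoint iint_rec (R : realType) (d : nat) (s : seq 'I_d)
    (g : 'rV[R]_d -> \bar R) (x : 'rV[R]_d) : \bar R :=
  match s with
  | [::] => g x
  | i :: s' => (\int[lebesgue_measure]_(u in `[0%R, 1%R]) iint_rec s' g (set_coord x i u))%E
  end.

Definition cube_integral (R : realType) (d : nat) (g : 'rV[R]_d -> \bar R) : \bar R :=
  iint_rec (enum 'I_d) g 0.

Definition unit_cube (R : realType) (d : nat) : set 'rV[R]_d :=
  [set x | forall i, 0 <= x ord0 i <= 1].

Definition coord_vec (R : realType) (d : nat) (i : 'I_d) : 'rV[R]_d :=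
  delta_mx ord0 i.

Definition iter_partial (R : realType) (d : nat) (s : seq 'I_d)
    (phi : 'rV[R]_d -> R) : 'rV[R]_d -> R :=
  foldr (fun i h => 'D_(@coord_vec R d i) h) phi s.

(* C^infty with compact support in the open cube (0,1)^d *)
Definition test_function (R : realType) (d : nat) (phi : 'rV[R]_d -> R) : Prop :=
  (forall s : seq 'I_d, continuous (iter_partial s phi) /\
     forall (i : 'I_d) (x : 'rV[R]_d), derivable (iter_partial s phi) x (@coord_vec R d i))
  /\ exists2 delta : R, 0 < delta &
       forall x : 'rV[R]_d, (exists i, x ord0 i < delta \/ 1 - delta < x ord0 i) ->
         phi x = 0.

Definition mixed2 (R : realType) (d : nat) (e : {set 'I_d}) (phi : 'rV[R]_d -> R)
  : 'rV[R]_d -> R :=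
  iter_partial (flatten [seq [:: i; i] | i <- enum e]) phi.

Definition rv_of_tuple (R : realType) (d : nat) (x : d.-tuple R) : 'rV[R]_d :=
  \row_i tnth x i.

(* f is (the continuous representative of) an element of H^2_mix([0,1]^d)
   with norm <= 1: the weak derivatives g e = (prod_{i in e} d^2/dx_i^2) f
   exist in L_2 and sum_e ||g e||_2^2 <= 1. *)
Definition H2mix_unit_ball (R : realType) (d : nat) (f : 'rV[R]_d -> R) : Prop :=
  {within @unit_cube R d, continuous f} /\
  exists g : {set 'I_d} -> 'rV[R]_d -> R,
    (forall e, measurable_fun [set: d.-tuple R] (g e \o @rv_of_tuple R d)) /\
    (forall e phi, test_function phi ->
       cube_integral (fun x => (f x * mixed2 e phi x)%:E) =
       cube_integral (fun x => (g e x * phi x)%:E)) /\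
    (\sum_(e : {set 'I_d}) cube_integral (fun x => (g e x ^+ 2)%:E) <= 1)%E.

Definition eQMC (R : realType) (d N : nat) (P : 'I_N -> 'rV[R]_d) : \bar R :=
  ereal_sup [set `| ((N%:R)^-1 * \sum_(k < N) f (P k))%:E
                     - cube_integral (fun x => (f x)%:E) |%E
            | f in [set f | H2mix_unit_ball f]].

(* Main.v *)
Require Import Defs.
From HB Require Import structures.
From mathcomp Require Import all_boot all_order all_algebra.
From mathcomp Require Import all_classical all_reals all_analysis.
From mathcomp Require Import measurable_realfun.
From mathcomp Require Import zify ring lra.
Set Implicit Arguments. Unset Strict Implicit. Unset Printing Implicit Defensive.
Import Order.TTheory GRing.Theory Num.Theory.
Import numFieldNormedType.Exports.
Local Open Scope ring_scope.

(** For [f] in the unit ball and a finite signed point measure [sum_q a_q delta_(x_q)]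
    on the cube, the weak derivatives of [f] are tested against smooth tensor products
    approximating [sum_q a_q prod_i ker (i \in E) (x_q i) (y i)], where
    [ker true x y = (y - x)_+ - (y - x) S(y)], [ker false x y = ((y - x) S(y))'']
    and [S] is a smooth cutoff. Since [(ker true x)'' + ker false x] is the point mass at [x],
    expanding the product over the coordinates and summing over the sets [E] gives
    [|sum_q a_q f(x_q)| <= 2^d sup |sum_q a_q prod_i ker|], which reduces the quadrature
    error of the unit ball to that of the functions [prod_i ker (i \in E) (x i) (y i)].

    As a function of [u], [ker b |2u - 1| y] is a combination of constants and of
    functions [|u - c|], whose Walsh coefficients are at most [2^-(a1 + a2)], with [a1 > a2]
    the two largest indices of the frequency. The error of the net is the sum of the Walsh
    coefficients over the nonzero dual frequencies. By the net property those have weight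
    above [2n - t], and at most [2^(s./2 - (2n - t)./2)] of them share a given profile of
    pairs [(a1, a2)] of total weight [s]; as there are at most [(2n + 1)^(2d - 1)] profiles
    of weight [s], a geometric sum remains. *)

(** * Elementary estimates *)

Section HalfPowers.
Variable R : realFieldType.

Lemma half_exp_gt0 m : 0 < (2^-1 : R) ^+ m.
Proof. by rewrite exprn_gt0 // invr_gt0. Qed.

Lemma half_exp_ge0 m : 0 <= (2^-1 : R) ^+ m.
Proof. exact: ltW (half_exp_gt0 m). Qed.

Lemma half_expK m : (2^-1 : R) ^+ m * 2 ^+ m = 1.
Proof. by rewrite -exprMn mulVf ?pnatr_eq0 // expr1n. Qed.

Lemma ler_half_exp m n : (m <= n)%N -> (2^-1 : R) ^+ n <= 2^-1 ^+ m.
Proof. by apply: ler_wiXn2l; rewrite ?invr_ge0 // invf_le1 // ler1n. Qed.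

Lemma sum_half_uphalf_le q M :
  \sum_(q <= s < M) (2^-1 : R) ^+ uphalf s <= 4 * 2^-1 ^+ uphalf q.
Proof.
have [Mq|qM] := leqP M q; first by rewrite big_geq // mulr_ge0 // half_exp_ge0.
pose T s := - 2 * (2^-1 ^+ uphalf s + 2^-1 ^+ uphalf s.+1) : R.
rewrite (eq_bigr (fun s => T s.+1 - T s)) => [|s _]; last first.
  by rewrite /T [uphalf s.+2]/= exprS; field.
rewrite telescope_sumr ?(ltnW qM) // /T.
have : (2^-1 : R) ^+ uphalf q.+1 <= 2^-1 ^+ uphalf q.
  by apply: ler_half_exp; rewrite /= uphalf_half; case: (odd q).
by have := half_exp_ge0 (uphalf M); have := half_exp_ge0 (uphalf M.+1); lra.
Qed.

End HalfPowers.

Lemma half_exp_subn_le (R : realFieldType) m t : 2^-1 ^+ (m - t) <= 2 ^+ t * 2^-1 ^+ m :> R.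
Proof.
have [t_le|t_gt] := leqP t m.
  by rewrite -{2}(subnK t_le) exprD mulrCA [2 ^+ t * _]mulrC half_expK mulr1.
have -> : (m - t = 0)%N by apply/eqP; rewrite subn_eq0 ltnW.
rewrite expr0 -[leLHS](half_expK R m) mulrC ler_wpM2r ?half_exp_ge0 //.
by rewrite ler_weXn2l ?ler1n // ltnW.
Qed.

Lemma exists_half_exp_le (R : realType) (delta : R) : 0 < delta -> exists m, 2^-1 ^+ m <= delta.
Proof.
move=> delta_gt0; exists (Num.truncn delta^-1).+1.
rewrite exprVn -[leRHS]invrK lef_pV2 ?posrE ?invr_gt0 ?exprn_gt0 //.
apply/ltW/(lt_trans (truncnS_gt _)).
by rewrite -natrX ltr_nat ltn_expl.
Qed.

Lemma ler_addgt0M (R : realFieldType) (c x y : R) : 0 <= c ->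
  (forall e, 0 < e -> x <= y + c * e) -> x <= y.
Proof.
move=> c_ge0 x_le; apply/ler_addgt0Pr => e e_gt0.
apply: le_trans (x_le (e / (c + 1)) _) _; first by rewrite divr_gt0 // ltr_wpDl.
by rewrite lerD2l mulrCA ger_pMr // ler_pdivrMr ?ltr_wpDl // mul1r lerDl.
Qed.

Lemma prod_dist (R : realFieldType) m (a b : 'I_m -> R) (A e : R) : 0 <= e ->
  (forall i, `|a i| <= A) -> (forall i, `|b i| <= A) -> (forall i, `|a i - b i| <= A * e) ->
  `|\prod_i a i - \prod_i b i| <= m%:R * A ^+ m * e.
Proof.
move=> e_ge0; elim: m a b => [|m IH] a b a_le b_le ab_le.
  by rewrite !big_ord0 subrr normr0 !mul0r.
have A_ge0 : 0 <= A := le_trans (normr_ge0 _) (a_le ord0).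
rewrite !big_ord_recl; set p := \prod_i a _; set q := \prod_i b _.
have p_le : `|p| <= A ^+ m.
  rewrite normr_prod -[X in A ^+ X]card_ord -prodr_const ler_prod // => i _.
  by rewrite normr_ge0 /=.
have pq_le : `|p - q| <= m%:R * A ^+ m * e by apply: IH.
have -> : a ord0 * p - b ord0 * q = (a ord0 - b ord0) * p + b ord0 * (p - q) by ring.
apply: le_trans (ler_normD _ _) _; rewrite !normrM.
apply: le_trans (lerD (ler_pM _ _ (ab_le ord0) p_le) (ler_pM _ _ (b_le ord0) pq_le)) _ => //.
by rewrite -natr1 exprS le_eqVlt; apply/orP; left; apply/eqP; ring.
Qed.

(** * Dual frequencies of an order 2 net *)

Section TopIndices.
Variable m : nat.
Implicit Types (S T : {set 'I_m}) (j : 'I_m).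

(* Indices are 1-based, so that 0 stands for the absence of an element. *)
Definition max_index S : nat := (\max_(j in S) j.+1)%N.
Definition drop_max S : {set 'I_m} := [set j in S | j.+1 != max_index S].

Lemma ltn_max_index S j : j \in S -> (j < max_index S)%N.
Proof. by move=> jS; rewrite /max_index (bigD1 j) //= leq_maxl. Qed.

Lemma max_index_leP S p :
  reflect (forall j, j \in S -> (j < p)%N) (max_index S <= p)%N.
Proof. exact: bigmax_leqP. Qed.

Lemma max_index_attained S : (0 < max_index S)%N -> exists2 j, j \in S & j.+1 = max_index S.
Proof.
have [->|[j jS] _] := set_0Vmem S; first by rewrite /max_index big_set0.
have S_gt0 : (0 < #|S|)%N by apply/card_gt0P; exists j.
by have [k kS max_k] := eq_bigmax_cond (fun j : 'I_m => j.+1) S_gt0; exists k.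
Qed.

Lemma max_index_drop_max_le S : (max_index (drop_max S) <= max_index S)%N.
Proof. by apply/max_index_leP => j /setIdP[jS _]; apply: ltn_max_index. Qed.

Lemma max_index_le_dim S : (max_index S <= m)%N.
Proof. by apply/max_index_leP. Qed.

Lemma top2_max_index S j : j \in top2 S ->
  (j.+1 == max_index S) || (j.+1 == max_index (drop_max S)).
Proof.
rewrite inE => /andP[jS]; apply: contraTT => /norP[j_notmax j_notmax2].
have jD : j \in drop_max S by rewrite inE jS.
have j_lt_max2 : (j.+1 < max_index (drop_max S))%N by rewrite ltn_neqAle j_notmax2 ltn_max_index.
have [k /setIdP[kS k_notmax] k_max2] := max_index_attained (ltn_trans (ltn0Sn j) j_lt_max2).
have jk : (j < k)%N by rewrite -ltnS k_max2.
have [l lS l_max] := max_index_attained (leq_ltn_trans (leq0n j) (ltn_max_index jS)).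
have jl : (j < l)%N by rewrite -ltnS l_max (leq_trans j_lt_max2) ?max_index_drop_max_le.
have lk : l != k by apply: contraNneq k_notmax => <-; rewrite l_max.
rewrite -leqNgt; have <- : #|[set l; k]| = 2%N by rewrite cards2 lk.
apply: subset_leq_card; apply/fintype.subsetP => i; rewrite !inE => /orP[]/eqP->.
  by rewrite lS.
by rewrite kS.
Qed.

Lemma top2_weight_le S : (top2_weight S <= max_index S + max_index (drop_max S))%N.
Proof.
have sum_eq c : (\sum_(j < m | j.+1 == c) j.+1 <= c)%N.
  have [j /eqP ej|none] := pickP (fun j : 'I_m => j.+1 == c); last by rewrite big_pred0.
  rewrite (bigD1 j) ?ej //= big1 ?addn0 // => k /andP[/eqP ek].
  by rewrite -val_eqE /= -eqSS ek ej eqxx.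
apply: leq_trans (leq_add (sum_eq _) (sum_eq _)).
rewrite /top2_weight big_mkcond [X in (_ <= X + _)%N]big_mkcond.
rewrite [X in (_ <= _ + X)%N]big_mkcond -big_split /=.
apply: leq_sum => j _; case: ifP => [/top2_max_index/orP[]->|//]; last exact: leq_addl.
exact: leq_addr.
Qed.

Lemma card_le_max_index S : (#|S| <= max_index S)%N.
Proof.
rewrite cardE -(size_map val) -[leqRHS](size_iota 0); apply: uniq_leq_size.
  by rewrite map_inj_uniq ?enum_uniq //; apply: val_inj.
move=> _ /mapP[j jS ->]; rewrite mem_iota /=; apply: ltn_max_index.
by rewrite mem_enum in jS.
Qed.

Lemma card_double_le S : (#|S|.*2 <= (max_index S + max_index (drop_max S)).+1)%N.
Proof.
have card_drop : (#|S| <= #|drop_max S|.+1)%N.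
  have [max_eq0|/max_index_attained[k kS max_k]] := posnP (max_index S).
    by rewrite (leq_trans (card_le_max_index S)) // max_eq0.
  rewrite (cardsD1 k S) kS ltnS; apply: subset_leq_card; apply/fintype.subsetP => j.
  by rewrite !inE -max_k eqSS val_eqE andbC.
rewrite -addnn -addnS; apply: leq_add; first exact: card_le_max_index.
by apply: leq_trans card_drop _; rewrite ltnS card_le_max_index.
Qed.

Lemma ltn_max_index_setD S T j : max_index S = max_index T ->
  max_index (drop_max S) = max_index (drop_max T) ->
  j \in S -> j \notin T -> (j < (max_index (drop_max S)).-1)%N.
Proof.
move=> eST eDST jS jT.
have not_max U : (j.+1 == max_index U) -> U \subset T -> False.
  move=> /eqP max_j /fintype.subsetP UT.
  have [|k /UT kT max_k] := max_index_attained (S := U); first by rewrite -max_j.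
  by move: jT; rewrite (_ : j = k) ?kT //; apply/val_inj/succn_inj; rewrite max_k.
have jD : j \in drop_max S.
  by rewrite inE jS eST; apply/negP => /not_max; apply.
have DT : drop_max T \subset T by apply/fintype.subsetP => k /setIdP[].
have : j.+1 != max_index (drop_max S).
  by rewrite eDST; apply/negP => /not_max/(_ DT).
by have := ltn_max_index jD; lia.
Qed.

End TopIndices.

Definition supp (V : nmodType) m (r : 'rV[V]_m) : {set 'I_m} := [set j | r ord0 j != 0].

(* Dick's weight mu_2. *)
Definition row_wt (V : nmodType) m (r : 'rV[V]_m) : nat :=
  (max_index (supp r) + max_index (drop_max (supp r)))%N.

Lemma supp0 (V : nmodType) m : supp (0 : 'rV[V]_m) = finset.set0.
Proof. by apply/setP => j; rewrite !inE mxE eqxx. Qed.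

Lemma max_index_supp_eq0 (V : nmodType) m (r : 'rV[V]_m) : max_index (supp r) = 0%N -> r = 0.
Proof.
move=> max_eq0; apply/rowP => j; rewrite mxE; apply/eqP; apply: contraT => rj.
by have := @ltn_max_index _ (supp r) j; rewrite inE rj max_eq0 => /(_ isT).
Qed.

Lemma F2_neq0_eq1 (x : 'F_2) : x != 0 -> x = 1.
Proof. by case: x => [[|[|//]]] i //= _; apply: val_inj. Qed.

Lemma row_wt0 (V : nmodType) m : row_wt (0 : 'rV[V]_m) = 0%N.
Proof.
have max_eq0 : max_index (supp (0 : 'rV[V]_m)) = 0%N by rewrite supp0 /max_index big_set0.
by have := max_index_drop_max_le (supp (0 : 'rV[V]_m)); rewrite /row_wt max_eq0 leqn0 => /eqP.
Qed.

HB.instance Definition _ (I : finType) (V : finZmodType) := GRing.Zmodule.on {ffun I -> V}.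

Section CardDifferences.
Variable V : finZmodType.
Implicit Types A B : {set V}.

Lemma card_le_differences A B :
  {in A &, forall x y, x - y \in B} -> (#|A| <= #|B|)%N.
Proof.
move=> AB; have [->|[x0 x0A]] := set_0Vmem A; first by rewrite cards0.
rewrite -(card_imset (mem A) (addIr (- x0))); apply: subset_leq_card.
by apply/fintype.subsetP => _ /imsetP[x xA ->]; apply: AB.
Qed.

Lemma card_le_double_kernel A (f : V -> 'F_2) :
  {in A &, forall x y, x - y \in A} -> {morph f : x y / x - y} ->
  (#|A| <= 2 * #|[set x in A | f x == 0%R]|)%N.
Proof.
move=> subA fB; rewrite -(cardsID [set x | f x == 0] A) mul2n -addnn.
apply: leq_add; first by rewrite setIdE.
apply: card_le_differences => x y /finset.setDP[xA]; rewrite inE => fx /finset.setDP[yA].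
by rewrite !inE subA // fB (F2_neq0_eq1 fx) => /F2_neq0_eq1 ->; rewrite subrr eqxx.
Qed.

End CardDifferences.

Lemma sum_pair_bool (I : finType) (f : I * bool -> nat) :
  (\sum_x f x = \sum_i (f (i, false) + f (i, true)))%N.
Proof.
transitivity (\sum_i \sum_b f (i, b))%N; first by rewrite pair_bigA; apply: eq_bigr => -[].
by apply: eq_bigr => i _; rewrite big_bool addnC.
Qed.

Lemma card_ffun_sum_eq (I : finType) (i0 : I) (m s : nat) :
  (#|[set f : {ffun I -> 'I_m.+1} | (\sum_i f i)%N == s]| <= m.+1 ^ #|I|.-1)%N.
Proof.
pose phi (f : {ffun I -> 'I_m.+1}) := [ffun i => if i == i0 then ord0 else f i].
have inj : {in [set f : {ffun I -> 'I_m.+1} | (\sum_i f i)%N == s] &, injective phi}.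
  move=> f g; rewrite !inE => /eqP sum_f /eqP sum_g /ffunP eq_phi.
  have fg i : i != i0 -> f i = g i by move=> ni; have := eq_phi i; rewrite !ffunE (negbTE ni).
  apply/ffunP => i; have [->|/fg//] := eqVneq i i0; apply: val_inj => /=.
  move: sum_f; rewrite -sum_g (bigD1 i0) //= [RHS](bigD1 i0) //=.
  by rewrite (eq_bigr (fun i => val (g i))) => [/addIn//|j nj]; rewrite (fg j nj).
rewrite -(card_in_imset inj) -(cardC1 i0) -[X in (X ^ _)%N]card_ord.
rewrite -(card_pffun_on ord0 (mem (predC1 i0)) (mem predT)); apply: subset_leq_card.
apply/fintype.subsetP => _ /imsetP[f _ ->]; apply/pffun_onP; split=> //.
by apply/fintype.subsetP => i; rewrite !inE ffunE; have [//|] := eqVneq i i0; rewrite ?eqxx.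
Qed.

Section DualNet.
Variables (d t n : nat) (C : 'I_d -> 'M['F_2]_(2 * n, n)).
Hypothesis netC : order2_digital_net t C.

Local Notation freq := {ffun 'I_d -> 'rV['F_2]_(2 * n)}.
Implicit Types k : freq.

Definition dual k : bool := \sum_i k i *m C i == 0.
Definition freq_wt k : nat := (\sum_i row_wt (k i))%N.

Lemma dualB k k' : dual k -> dual k' -> dual (k - k').
Proof.
rewrite /dual => /eqP dk /eqP dk'; apply/eqP.
transitivity (\sum_i k i *m C i - \sum_i k' i *m C i); last by rewrite dk dk' subrr.
by rewrite -sumrB; apply: eq_bigr => i _; rewrite !ffunE mulmxBl.
Qed.

Lemma dual_wt_gt k : dual k -> k != 0 -> (2 * n - t < freq_wt k)%N.
Proof.
move=> /eqP dk; apply: contraNT; rewrite -leqNgt => wt_le.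
have [t_big|t_small] := ltnP (2 * n) t.
  apply/eqP/ffunP => i; rewrite ffunE; apply: max_index_supp_eq0.
  by move: wt_le; rewrite /freq_wt (bigD1 i) //= /row_wt; lia.
have card_supp i : (#|supp (k i)| <= n)%N.
  have := card_double_le (supp (k i)); move: wt_le.
  by rewrite /freq_wt (bigD1 i) //= /row_wt; lia.
have top2_le : (\sum_(i < d) top2_weight (supp (k i)) + t <= 2 * n)%N.
  rewrite addnC -leq_subRL //; apply: leq_trans wt_le.
  by apply: leq_sum => i _; apply: top2_weight_le.
have indep := netC card_supp top2_le (a := fun i j => k i ord0 j).
have {}dk : \sum_(i < d) \sum_(j in supp (k i)) k i ord0 j *: row j (C i) = 0.
  rewrite -[RHS]dk; apply: eq_bigr => i _.
  rewrite mulmx_sum_row [RHS](bigID (mem (supp (k i)))) /= [X in _ = _ + X]big1 ?addr0 // => j.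
  by rewrite inE negbK => /eqP ->; rewrite scale0r.
apply/eqP/ffunP => i; rewrite ffunE; apply/rowP => j; rewrite mxE.
by have [//|kij] := eqVneq (k i ord0 j) 0; apply: indep => //; rewrite inE.
Qed.

Definition dual_box (p : 'I_d -> nat) : {set freq} :=
  [set k | dual k & [forall i, max_index (supp (k i)) <= p i]%N].

Lemma dual_boxP p k :
  reflect (dual k /\ forall i (j : 'I_(2 * n)), (p i <= j)%N -> k i ord0 j = 0) (k \in dual_box p).
Proof.
rewrite inE; apply: (iffP andP) => -[dk box]; split=> //.
  move=> i j p_j; apply: contraTeq p_j => kij; rewrite -ltnNge.
  by have /max_index_leP := forallP box i; apply; rewrite inE.
apply/forallP => i; apply/max_index_leP => j; rewrite inE ltnNge.
by apply: contraNN => /box ->.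
Qed.

Lemma card_dual_box_pred p i :
  (#|dual_box p| <= 2 * #|dual_box (fun j => if j == i then (p i).-1 else p j)|)%N.
Proof.
pose f k : 'F_2 := \sum_(j < 2 * n | val j == (p i).-1) k i ord0 j.
have fB : {morph f : k k' / k - k'}.
  by move=> k k'; rewrite /f -sumrB; apply: eq_bigr => j _; rewrite !ffunE !mxE.
have boxB : {in dual_box p &, forall k k', k - k' \in dual_box p}.
  move=> k k' /dual_boxP[dk box_k] /dual_boxP[dk' box_k']; apply/dual_boxP.
  split=> [|i' j p_j]; first exact: dualB.
  by rewrite !ffunE !mxE box_k // box_k' // subrr.
apply: (leq_trans (card_le_double_kernel boxB fB)); rewrite leq_mul2l /=.
apply: subset_leq_card; apply/fintype.subsetP => k /setIdP[/dual_boxP[dk box_k] /eqP fk_eq0].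
apply/dual_boxP; split=> // i' j; case: eqP => [->|_]; last exact: box_k.
have [/box_k //|lt_j] := leqP (p i) j; move=> le_j.
have val_j : val j = (p i).-1 by move: lt_j le_j => /=; lia.
rewrite -fk_eq0 /f (bigD1 j) ?val_j //= big1 ?addr0 // => l /andP[/eqP el] /eqP[].
by apply: val_inj; rewrite /= el -val_j.
Qed.

Lemma card_dual_box p s : (\sum_i p i <= (2 * n - t)./2 + s)%N -> (#|dual_box p| <= 2 ^ s)%N.
Proof.
elim: s p => [|s IH] p sum_p.
  apply: (@leq_trans #|[set (0 : freq)]|); last by rewrite cards1.
  apply: subset_leq_card; apply/fintype.subsetP => k.
  rewrite inE => /andP[dk /forallP box]; rewrite inE; apply: contraT => /(dual_wt_gt dk).
  rewrite ltnNge => /negP[]; apply: (@leq_trans (\sum_i p i).*2); last by move: sum_p; lia.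
  rewrite -muln2 big_distrl /=; apply: leq_sum => i _; rewrite muln2 -addnn.
  by apply: leq_add => //; apply: leq_trans (max_index_drop_max_le _) _.
have [/IH le_s|gt_s] := leqP (\sum_i p i) ((2 * n - t)./2 + s).
  by rewrite (leq_trans le_s) // leq_exp2l.
have [i p_i|p_npos] := pickP (fun i => 0 < p i)%N; last first.
  by move: gt_s; rewrite big1 ?ltn0 // => i _; apply/eqP; have := p_npos i; lia.
apply: leq_trans (card_dual_box_pred p i) _; rewrite expnS leq_mul2l /=; apply: IH.
rewrite -ltnS -addnS; apply: leq_trans sum_p.
rewrite (bigD1 i) //= eqxx [leqRHS](bigD1 i) //= -addSn prednK // leq_add2l.
by apply: leq_sum => j /negbTE ->.
Qed.

Local Notation profiles := {ffun 'I_d * bool -> 'I_(2 * n).+1}.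

Definition profile k : profiles :=
  [ffun x => inord (max_index (if x.2 then drop_max (supp (k x.1)) else supp (k x.1)))].

Lemma profileE k i b :
  profile k (i, b) = max_index (if b then drop_max (supp (k i)) else supp (k i)) :> nat.
Proof. by rewrite ffunE inordK // ltnS max_index_le_dim. Qed.

Lemma sum_profile k : (\sum_x profile k x)%N = freq_wt k.
Proof. by rewrite sum_pair_bool; apply: eq_bigr => i _; rewrite !profileE. Qed.

Lemma card_dual_profile (v : profiles) :
  (#|[set k | dual k & profile k == v]| <= 2 ^ ((\sum_x v x)./2 - (2 * n - t)./2))%N.
Proof.
have [->|[k0]] := set_0Vmem [set k | dual k & profile k == v]; first by rewrite cards0.
rewrite inE => /andP[_ /eqP v_k0].
have v_le (i : 'I_d) : (v (i, true) <= v (i, false))%N.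
  by rewrite -v_k0 !profileE max_index_drop_max_le.
apply: (@leq_trans #|dual_box (fun i => (v (i, true)).-1)|); last first.
  apply: card_dual_box; rewrite -maxnE leq_max; apply/orP; right.
  rewrite geq_half_double -mul2n (sum_pair_bool (fun x => v x : nat)) big_distrr /=.
  by apply: leq_sum => i _ /=; have := v_le i; lia.
apply: card_le_differences => k k'; rewrite !inE.
move=> /andP[dk /eqP profile_k] /andP[dk' /eqP profile_k'].
apply/andP; split; first exact: dualB.
apply/forallP => i; apply/max_index_leP => j; rewrite inE !ffunE !mxE.
have eqk b : max_index (if b then drop_max (supp (k i)) else supp (k i))
    = max_index (if b then drop_max (supp (k' i)) else supp (k' i)).
  by rewrite -!profileE profile_k profile_k'.
have lt_k : j \in supp (k i) -> j \notin supp (k' i) ->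
    (j < (max_index (drop_max (supp (k i)))).-1)%N.
  exact: ltn_max_index_setD (eqk false) (eqk true).
have lt_k' : j \in supp (k' i) -> j \notin supp (k i) ->
    (j < (max_index (drop_max (supp (k' i)))).-1)%N.
  exact: ltn_max_index_setD (esym (eqk false)) (esym (eqk true)).
have [kij|kij] := eqVneq (k i ord0 j) 0; have [k'ij|k'ij] := eqVneq (k' i ord0 j) 0.
- by rewrite kij k'ij subrr eqxx.
- by rewrite -profile_k' profileE lt_k' // inE ?kij ?k'ij ?eqxx.
- by rewrite -profile_k profileE lt_k // inE ?kij ?k'ij ?eqxx.
- by rewrite (F2_neq0_eq1 kij) (F2_neq0_eq1 k'ij) subrr eqxx.
Qed.

Hypothesis d_gt0 : (0 < d)%N.

Lemma card_dual_wt s :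
  (#|[set k | dual k & freq_wt k == s]|
     <= (2 * n).+1 ^ (2 * d - 1) * 2 ^ (s./2 - (2 * n - t)./2))%N.
Proof.
pose V := [set v : profiles | (\sum_x v x)%N == s].
have cardV : (#|V| <= (2 * n).+1 ^ (2 * d - 1))%N.
  apply: leq_trans (card_ffun_sum_eq (Ordinal d_gt0, true) (2 * n) s) _.
  by rewrite card_prod card_ord card_bool [(d * 2)%N]mulnC subn1.
apply: (@leq_trans (\sum_(v in V) 2 ^ (s./2 - (2 * n - t)./2))); last first.
  by rewrite sum_nat_const leq_mul2r cardV orbT.
rewrite -sum1_card (partition_big profile (mem V)) /= => [|k]; last first.
  by rewrite !inE => /andP[_ /eqP <-]; rewrite sum_profile.
apply: leq_sum => v; rewrite inE => /eqP <-; apply: leq_trans (card_dual_profile v).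
rewrite -sum1_card; apply: eq_leq; apply: eq_bigl => k; rewrite !inE.
have [<-|] := eqVneq (profile k) v; last by rewrite !andbF.
by rewrite sum_profile eqxx !andbT.
Qed.

Variable R : realFieldType.
Local Notation half := (2^-1 : R).

Lemma sum_dual_wt_le s : (2 * n - t < s)%N ->
  \sum_(k : freq | dual k && (freq_wt k == s)) half ^+ freq_wt k
    <= (2 * n).+1%:R ^+ (2 * d - 1) * half ^+ (2 * n - t)./2 * half ^+ uphalf s.
Proof.
set q := (2 * n - t)%N => qs.
rewrite (eq_bigr (fun=> half ^+ s)) => [|k /andP[_ /eqP ->//]].
rewrite sumr_const -[_ *+ _]mulr_natl -cardsE.
have := card_dual_wt s; rewrite -(ler_nat R) => /(ler_wpM2r (half_exp_ge0 R s)) /le_trans; apply.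
rewrite natrM !natrX -!mulrA ler_wpM2l ?exprn_ge0 //.
have -> : half ^+ s = half ^+ (s./2 - q./2) * (half ^+ q./2 * half ^+ uphalf s).
  rewrite -!exprD; congr (_ ^+ _); rewrite uphalf_half.
  by have := half_leq (ltnW qs); have := odd_double_half s; lia.
by rewrite mulrCA mulrA half_expK mul1r.
Qed.

Lemma dual_sum_le :
  \sum_(k : freq | dual k && (k != 0)) half ^+ freq_wt k
    <= 4 * (2 * n).+1%:R ^+ (2 * d - 1) * half ^+ (2 * n - t).
Proof.
set q := (2 * n - t)%N; set L : R := _ ^+ (2 * d - 1).
have L_ge0 : 0 <= L by rewrite exprn_ge0.
pose M := (\max_(k : freq) freq_wt k)%N.+1.
have wt_lt k : (freq_wt k < M)%N by rewrite ltnS leq_bigmax.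
rewrite (partition_big (fun k => Ordinal (wt_lt k)) (fun s => q < s)%N) /= => [|k /andP[]];
  last exact: dual_wt_gt.
apply: (@le_trans _ _ (\sum_(s < M | (q < s)%N) L * half ^+ q./2 * half ^+ uphalf s)).
  apply: ler_sum => s /sum_dual_wt_le; apply: le_trans.
  rewrite big_mkcond [leRHS]big_mkcond; apply: ler_sum => k _; rewrite -val_eqE /=.
  case: (dual k) (freq_wt k == s) => [] [] //=; rewrite ?andbT ?andbF //.
  by case: ifP => // _; apply: half_exp_ge0.
rewrite -mulr_sumr -(big_mkord (fun s => q < s)%N (fun s => half ^+ uphalf s)).
rewrite -(@big_nat_widenl _ _ _ q.+1 0 M xpredT) //.
have Lq_ge0 : 0 <= L * half ^+ q./2 by rewrite mulr_ge0 ?half_exp_ge0.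
apply: le_trans (ler_wpM2l Lq_ge0 (sum_half_uphalf_le R q.+1 M)) _.
rewrite mulrACA [4 * L]mulrC -!mulrA -exprD !ler_wpM2l //; apply: ler_half_exp.
by rewrite /= -[leqLHS]odd_double_half; case: (odd q); lia.
Qed.

End DualNet.

(** * Walsh coefficients of polygonal functions *)

Section Walsh.
Variables (R : realFieldType) (m : nat).
Implicit Types (b : 'cV['F_2]_m) (r : 'rV['F_2]_m) (g : 'cV['F_2]_m -> R).

Definition sgn (x : 'F_2) : R := (-1) ^+ (x != 0).

Lemma sgn0 : sgn 0 = 1. Proof. by rewrite /sgn eqxx. Qed.
Lemma sgn1 : sgn 1 = -1. Proof. by rewrite /sgn oner_eq0. Qed.

Lemma sgnD x y : sgn (x + y) = sgn x * sgn y.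
Proof.
have [->|/F2_neq0_eq1->] := eqVneq x 0; first by rewrite add0r sgn0 mul1r.
have [->|/F2_neq0_eq1->] := eqVneq y 0; first by rewrite addr0 sgn0 mulr1.
have -> : (1 + 1 : 'F_2) = 0 by apply: val_inj.
by rewrite sgn0 sgn1 mulrNN mulr1.
Qed.

Lemma normr_sgn x : `|sgn x| = 1.
Proof. by rewrite /sgn normrX normrN1 expr1n. Qed.

Definition chi r b : R := sgn ((r *m b) ord0 ord0).

Lemma normr_chi r b : `|chi r b| = 1.
Proof. exact: normr_sgn. Qed.

Lemma chi0 b : chi 0 b = 1.
Proof. by rewrite /chi mul0mx mxE sgn0. Qed.

Lemma chiDr r b c : chi r (b + c) = chi r b * chi r c.
Proof. by rewrite /chi mulmxDr mxE sgnD. Qed.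

Lemma chi_suml (I : finType) (F : I -> 'rV['F_2]_m) b :
  chi (\sum_i F i) b = \prod_i chi (F i) b.
Proof.
apply: (big_morph (fun r => chi r b)) => [r s|]; last exact: chi0.
by rewrite /chi mulmxDl mxE sgnD.
Qed.

Lemma chi_delta r j : r ord0 j != 0 -> chi r (delta_mx j ord0) = -1.
Proof.
move=> rj; rewrite /chi mxE (bigD1 j) //= mxE !eqxx mulr1 (F2_neq0_eq1 rj).
rewrite big1 ?addr0 ?sgn1 // => k /negbTE kj.
by rewrite mxE kj mulr0.
Qed.

Lemma addr_delta_bij (j : 'I_m) : bijective (fun b => b + delta_mx j ord0).
Proof. by exists (fun b => b - delta_mx j ord0) => b; rewrite ?addrK ?subrK. Qed.

Lemma sum_chi_col r : \sum_b chi r b = if r == 0 then 2 ^+ m else 0.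
Proof.
case: eqVneq => [->|r_neq0].
  under eq_bigr do rewrite chi0.
  by rewrite sumr_const card_mx muln1 card_Fp // natrX.
have [j rj] : exists j, r ord0 j != 0.
  apply/existsP; apply: contraNT r_neq0 => /existsPn r_eq0; apply/eqP/rowP => j.
  by rewrite mxE; apply/eqP; have := r_eq0 j; rewrite negbK.
set S := \sum_b _; suff : S = - S by lra.
rewrite {1}/S (reindex _ (onW_bij _ (addr_delta_bij j))) -sumrN; apply: eq_bigr => b _.
by rewrite chiDr chi_delta // mulrN1.
Qed.

Lemma sum_chi_row b : \sum_r chi r b = if b == 0 then 2 ^+ m else 0.
Proof.
rewrite (reindex (fun c : 'cV['F_2]_m => c^T)) /=; last first.
  by exists trmx => c _; rewrite trmxK.
rewrite (eq_bigr (chi b^T)) => [|c _]; last first.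
  by rewrite /chi -[c^T *m b]trmxK trmx_mul trmxK mxE.
rewrite sum_chi_col; congr (if _ then _ else _).
by apply/eqP/eqP => [e|->]; [rewrite -[b]trmxK e trmx0 | rewrite trmx0].
Qed.

Definition walsh g r : R := 2^-1 ^+ m * \sum_b g b * chi r b.

Lemma walsh_inversion g b : g b = \sum_r walsh g r * chi r b.
Proof.
under eq_bigr do rewrite /walsh -mulrA.
rewrite -mulr_sumr; under eq_bigr do rewrite mulr_suml.
have orthogonal c : \sum_r g c * chi r c * chi r b = if c == b then g c * 2 ^+ m else 0.
  under eq_bigr do rewrite -mulrA -chiDr; rewrite -mulr_sumr sum_chi_row.
  rewrite addr_eq0 (_ : - b = b); first by case: ifP; rewrite ?mulr0.
  by apply/colP => i; rewrite mxE; have [->|/F2_neq0_eq1->] := eqVneq (b i ord0) 0;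
    rewrite ?oppr0 //; apply: val_inj.
rewrite exchange_big /= (bigD1 b) //= orthogonal eqxx big1 => [|c /negbTE cb]; last first.
  by rewrite orthogonal cb.
by rewrite addr0 mulrCA half_expK mulr1.
Qed.

Lemma eq_walsh g h r : g =1 h -> walsh g r = walsh h r.
Proof. by move=> gh; congr (_ * _); apply: eq_bigr => b _; rewrite gh. Qed.

Lemma walshB g h r : walsh (fun b => g b - h b) r = walsh g r - walsh h r.
Proof. by rewrite /walsh -mulrBr -sumrB; under eq_bigr do rewrite mulrBl. Qed.

Lemma walsh_lincomb (I : Type) (s : seq I) (a : I -> R) (g : I -> 'cV['F_2]_m -> R) r :
  walsh (fun b => \sum_(i <- s) a i * g i b) r = \sum_(i <- s) a i * walsh (g i) r.
Proof.
rewrite /walsh; under eq_bigr do rewrite mulr_suml.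
rewrite exchange_big mulr_sumr; apply: eq_bigr => i _.
by rewrite [RHS]mulrCA; congr (_ * _); rewrite mulr_sumr; under eq_bigr do rewrite -mulrA.
Qed.

Lemma walsh_addc a g r : r != 0 -> walsh (fun b => a + g b) r = walsh g r.
Proof.
move=> /negbTE r_neq0; rewrite /walsh; under eq_bigr do rewrite mulrDl.
by rewrite big_split -mulr_sumr sum_chi_col r_neq0 mulr0 /= add0r.
Qed.

Lemma walsh_norm_le g r M : (forall b, `|g b| <= M) -> `|walsh g r| <= M.
Proof.
move=> gM; rewrite normrM ger0_norm ?half_exp_ge0 //.
rewrite (_ : M = 2^-1 ^+ m * (2 ^+ m * M)); last by rewrite mulrA half_expK mul1r.
rewrite ler_wpM2l ?half_exp_ge0 //.
apply: (le_trans (ler_norm_sum _ _ _)).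
apply: (@le_trans _ _ (\sum_(b : 'cV['F_2]_m) M)); last first.
  by rewrite sumr_const card_mx muln1 card_Fp // -[M *+ _]mulr_natl natrX.
by apply: ler_sum => b _; rewrite normrM normr_chi mulr1.
Qed.

(* Translating by [delta_mx j ord0] changes the sign of [chi r]. *)
Lemma walsh_flip g r j : r ord0 j != 0 ->
  walsh g r = walsh (fun b => g b - g (b + delta_mx j ord0)) r / 2.
Proof.
move=> rj; suff translate : walsh (fun b => g (b + delta_mx j ord0)) r = - walsh g r.
  by rewrite walshB translate; field.
rewrite /walsh -mulrN -sumrN; congr (_ * _).
rewrite [RHS](reindex _ (onW_bij _ (addr_delta_bij j))); apply: eq_bigr => b _.
by rewrite chiDr chi_delta // mulrN1 mulrN opprK.
Qed.

Lemma walsh_flip_le g r j M : r ord0 j != 0 ->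
  (forall b, `|g b - g (b + delta_mx j ord0)| <= M) -> `|walsh g r| <= M / 2.
Proof.
move=> rj gM; rewrite (walsh_flip _ rj) normrM [`|2^-1|]ger0_norm ?invr_ge0 //.
by rewrite ler_wpM2r ?invr_ge0 // walsh_norm_le.
Qed.

End Walsh.

Section DyadicPoints.
Variable R : realFieldType.
Implicit Types (h : R -> R) (u v c : R).

Definition dyadic m (b : 'cV['F_2]_m) : R :=
  \sum_(l < m) (((b l ord0 != 0) : bool) : nat)%:R / 2 ^+ l.+1.

Lemma dyadic_cons m (x : 'F_2) (b : 'cV['F_2]_m) :
  dyadic (col_mx x%:M b : 'cV_(1 + m)) = ((x != 0 : bool)%:R + dyadic b) / 2.
Proof.
rewrite /dyadic big_ord_recl mulrDl; congr (_ + _).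
  have -> : (ord0 : 'I_(1 + m)) = lshift m ord0 by apply: val_inj.
  by rewrite col_mxEu mxE eqxx mulr1n expr1.
rewrite mulr_suml; apply: eq_bigr => i _.
have -> : lift ord0 i = rshift 1 i by apply: val_inj.
by rewrite col_mxEd /= /bump /= add1n exprS invfM mulrA mulrAC.
Qed.

Lemma dyadic_itv m (b : 'cV['F_2]_m) : 0 <= dyadic b <= 1.
Proof.
elim: m b => [|m IH] b; first by rewrite /dyadic big_ord0 lexx ler01.
change 'cV['F_2]_(1 + m) in b; rewrite -[b]vsubmxK [usubmx b]mx11_scalar dyadic_cons.
by have := IH (dsubmx b); case: (_ != 0) => /=; lra.
Qed.

Lemma dyadic_flip m (b : 'cV['F_2]_m) j :
  dyadic (b + delta_mx j ord0) = dyadic b + sgn R (b j ord0) * 2^-1 ^+ j.+1.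
Proof.
rewrite /dyadic (bigD1 j) //= [in RHS](bigD1 j) //= [RHS]addrAC; congr (_ + _); last first.
  by apply: eq_bigr => l /negbTE lj; rewrite !mxE lj addr0.
rewrite !mxE !eqxx exprVn; have [->|/F2_neq0_eq1->] := eqVneq (b j ord0) 0.
  by rewrite add0r oner_eq0 sgn0 mul0r add0r.
have -> : (1 + 1 : 'F_2) = 0 by apply: val_inj.
by rewrite eqxx sgn1 mul0r mul1r mulN1r subrr.
Qed.

Definition lipschitz01 A h : Prop :=
  forall u v, 0 <= u <= 1 -> 0 <= v <= 1 -> `|h u - h v| <= A * `|u - v|.

Lemma walsh_lipschitz_le A h m (r : 'rV['F_2]_m) j : lipschitz01 A h -> r ord0 j != 0 ->
  `|walsh (h \o @dyadic m) r| <= A / 2 * 2^-1 ^+ j.+1.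
Proof.
move=> lip_h rj; rewrite mulrAC; apply: (walsh_flip_le rj) => b /=.
apply: le_trans (lip_h _ _ (dyadic_itv _) (dyadic_itv _)) _.
by rewrite dyadic_flip opprD addNKr normrN normrM normr_sgn mul1r ger0_norm // half_exp_ge0.
Qed.

Lemma walsh_affine a c m (r : 'rV['F_2]_m) i j : i != j -> r ord0 i != 0 -> r ord0 j != 0 ->
  walsh ((fun u => a * u + c) \o @dyadic m) r = 0.
Proof.
move=> ij ri rj; rewrite (walsh_flip _ ri) (_ : walsh _ r = 0) ?mul0r //.
apply/eqP; rewrite -normr_le0 -[leRHS](mul0r 2^-1); apply: (walsh_flip_le rj) => b /=.
rewrite normr_le0; apply/eqP; rewrite (addrAC b (delta_mx j ord0)) !dyadic_flip !mxE.
by rewrite eq_sym (negbTE ij) addr0; ring.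
Qed.

Lemma sum_cV_recl m (G : 'cV['F_2]_(1 + m) -> R) :
  \sum_b G b = \sum_(b : 'cV['F_2]_m) (G (col_mx 0%:M b) + G (col_mx 1%:M b)).
Proof.
have split_half (x : 'F_2) :
    \sum_(b | usubmx b == x%:M) G b = \sum_(b : 'cV['F_2]_m) G (col_mx x%:M b).
  rewrite (reindex (fun b : 'cV['F_2]_m => col_mx x%:M b)) /=.
    by apply: eq_bigl => b; rewrite col_mxKu eqxx.
  exists dsubmx => [b _|b]; first by rewrite col_mxKd.
  by rewrite inE => /eqP e; rewrite -{2}[b]vsubmxK e.
rewrite big_split -!split_half (bigID (fun b => usubmx b == 0%:M)) /=; congr (_ + _).
apply: eq_bigl => b; rewrite [usubmx b]mx11_scalar.
have scalar_inj : injective (fun x : 'F_2 => x%:M : 'M['F_2]_1).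
  by move=> x y /matrixP/(_ ord0 ord0); rewrite !mxE eqxx !mulr1n.
rewrite !(inj_eq scalar_inj); have [->|/F2_neq0_eq1->] := eqVneq (usubmx b ord0 ord0) 0 => //.
Qed.

Lemma walsh_recl h m (r : 'rV['F_2]_(1 + m)) :
  walsh (h \o @dyadic (1 + m)) r
    = (walsh ((fun u => h (u / 2)) \o @dyadic m) (rsubmx r)
       + sgn R (r ord0 ord0) * walsh ((fun u => h ((1 + u) / 2)) \o @dyadic m) (rsubmx r)) / 2.
Proof.
have chi_cons (x : 'F_2) (b : 'cV['F_2]_m) :
    chi R r (col_mx x%:M b) = sgn R (r ord0 ord0 * x) * chi R (rsubmx r) b.
  rewrite /chi -{1}[r]hsubmxK mul_row_col mxE sgnD; congr (_ * _); congr (sgn R _).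
  by rewrite mul_mx_scalar !mxE mulrC; congr (r _ _ * _); apply: val_inj.
rewrite /walsh sum_cV_recl big_split exprS /=.
under eq_bigr do rewrite dyadic_cons chi_cons mulr0 sgn0 mul1r eqxx add0r.
under [X in _ * (_ + X)]eq_bigr do
  rewrite dyadic_cons chi_cons mulr1 oner_eq0 mulrCA.
rewrite -mulr_sumr.
by move: (\sum_b _) (\sum_b _) (2^-1 ^+ m) => x y z; field.
Qed.

Definition absdist c u : R := `|u - c|.

Lemma absdist_lipschitz c : lipschitz01 1 (absdist c).
Proof.
move=> u v _ _; rewrite mul1r /absdist; apply: le_trans (ler_dist_dist _ _) _.
by rewrite opprB addrA subrK.
Qed.

Lemma walsh_absdist_recl c m (r : 'rV['F_2]_(1 + m)) :
  walsh (absdist c \o @dyadic (1 + m)) r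
    = (walsh (absdist (2 * c) \o @dyadic m) (rsubmx r)
       + sgn R (r ord0 ord0) * walsh (absdist (2 * c - 1) \o @dyadic m) (rsubmx r)) / 4.
Proof.
have walsh_half a (h : R -> R) : (forall u, absdist a u / 2 = h u) ->
    walsh (h \o @dyadic m) (rsubmx r) = walsh (absdist a \o @dyadic m) (rsubmx r) / 2.
  move=> ah_half; rewrite /walsh -mulrA mulr_suml; congr (_ * _); apply: eq_bigr => b _ /=.
  by rewrite -ah_half mulrAC.
have half_abs x : `|x| / 2 = `|x / 2| by rewrite normrM [`|2^-1|]ger0_norm ?invr_ge0.
rewrite walsh_recl (walsh_half (2 * c) (fun u => absdist c (u / 2))) => [|u]; last first.
  by rewrite half_abs; congr `|_|; field.
rewrite (walsh_half (2 * c - 1) (fun u => absdist c ((1 + u) / 2))) => [|u]; last first.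
  by rewrite half_abs; congr `|_|; field.
by field.
Qed.

(* Only one half of [0, 1] has the kink [c] in its interior; on the other one the
   function is affine. *)
Lemma walsh_absdist_le m (r : 'rV['F_2]_m) (i j : 'I_m) c :
  (i < j)%N -> r ord0 i != 0 -> r ord0 j != 0 ->
  `|walsh (absdist c \o @dyadic m) r| <= 2^-1 ^+ (i.+1 + j.+1).
Proof.
elim: m r i j c => [|m IH] r i j c; first by case: i.
change ('rV['F_2]_(1 + m)) in r; change ('I_(1 + m)) in i, j.
case: (split_ordP j) => j' ->; first by rewrite (ord1 j').
move=> ij ri rj; have {}rj : rsubmx r ord0 j' != 0 by rewrite mxE.
rewrite walsh_absdist_recl; set s := sgn R _.
have quarter x y : `|(x + s * y) / 4| <= (`|x| + `|y|) / 4.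
  rewrite normrM [`|4^-1|]ger0_norm ?invr_ge0 // ler_wpM2r ?invr_ge0 //.
  by apply: le_trans (ler_normD _ _) _; rewrite normrM normr_sgn mul1r.
apply: le_trans (quarter _ _) _.
case: (split_ordP i) ij ri => i' -> /= ij ri.
  have := walsh_lipschitz_le (absdist_lipschitz (2 * c)) rj.
  have := walsh_lipschitz_le (absdist_lipschitz (2 * c - 1)) rj.
  by rewrite (ord1 i') /= add1n !exprS; lra.
have {}ri : rsubmx r ord0 i' != 0 by rewrite mxE.
have ij' : i' != j' by apply: contraTneq ij => ->; rewrite ltnn.
rewrite !add1n addSn addnS 2!exprS; have [c_ge|c_le] := leP (2^-1) c.
  rewrite (@eq_walsh _ _ _ ((fun u => (-1) * u + 2 * c) \o @dyadic m)) => [|b /=]; last first.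
    by rewrite /absdist ler0_norm; have := dyadic_itv b; lra.
  rewrite (walsh_affine _ _ ij' ri rj) normr0 add0r.
  by have := IH _ _ _ (2 * c - 1) ij ri rj; rewrite addSn addnS; lra.
rewrite [X in _ + `|X|](@eq_walsh _ _ _ ((fun u => 1 * u + (1 - 2 * c)) \o @dyadic m)) => [|b /=];
  last by rewrite /absdist ger0_norm; have := dyadic_itv b; lra.
rewrite (walsh_affine _ _ ij' ri rj) normr0 addr0.
by have := IH _ _ _ (2 * c) ij ri rj; rewrite addSn addnS; lra.
Qed.

(* The second components are the kinks and [A] bounds the total variation. *)
Definition polygonal (A : R) h : Prop :=
  exists (a : R) (s : seq (R * R)),
    [/\ `|a| + \sum_(p <- s) `|p.1| <= A, all (fun p => 0 <= p.2 <= 1) s &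
        forall u, h u = a + \sum_(p <- s) p.1 * absdist p.2 u].

Lemma polygonal_le A h u : polygonal A h -> 0 <= u <= 1 -> `|h u| <= A.
Proof.
move=> [a [s [aA /allP s01 ->]]] u01; apply: le_trans (ler_normD _ _) _; apply: le_trans aA.
rewrite lerD2l; apply: (le_trans (ler_norm_sum _ _ _)).
rewrite big_seq [leRHS]big_seq; apply: ler_sum => p /s01 p01.
by rewrite normrM ler_piMr // normr_id ler_norml; lra.
Qed.

Lemma polygonal_lipschitz A h : polygonal A h -> lipschitz01 A h.
Proof.
move=> [a [s [aA _ hE]]] u v u01 v01; rewrite !hE opprD addrACA subrr add0r -sumrB.
apply: (@le_trans _ _ ((\sum_(p <- s) `|p.1|) * `|u - v|)); last first.
  by rewrite ler_wpM2r // (le_trans _ aA) // lerDr.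
rewrite mulr_suml; apply: (le_trans (ler_norm_sum _ _ _)); apply: ler_sum => p _.
rewrite -mulrBr normrM ler_wpM2l //.
by have := absdist_lipschitz p.2 u01 v01; rewrite mul1r.
Qed.

Lemma walsh_polygonal_le A h m (r : 'rV['F_2]_m) : polygonal A h ->
  `|walsh (h \o @dyadic m) r| <= A * 2^-1 ^+ row_wt r.
Proof.
move=> poly_h; have [a [s [aA s01 hE]]] := poly_h.
have A_ge0 : 0 <= A by apply: le_trans aA; rewrite addr_ge0 ?sumr_ge0.
have [/max_index_supp_eq0 ->|] := posnP (max_index (supp r)).
  rewrite row_wt0 expr0 mulr1; apply: walsh_norm_le => b.
  by apply: (polygonal_le poly_h); apply: dyadic_itv.
move=> /max_index_attained[j]; rewrite /row_wt inE => rj ej.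
have [->|] := posnP (max_index (drop_max (supp r))).
  rewrite addn0 -ej; apply: le_trans (walsh_lipschitz_le (polygonal_lipschitz poly_h) rj) _.
  by rewrite ler_wpM2r ?half_exp_ge0 //; lra.
move=> /max_index_attained[i] /setIdP[ri ei]; rewrite inE in ri => ei'.
have ij : (i < j)%N.
  by have := @ltn_max_index _ (supp r) i; rewrite inE ri -ej => /(_ isT); rewrite -ej in ei; lia.
have r_neq0 : r != 0 by apply: contraNneq rj => ->; rewrite mxE.
rewrite (eq_walsh _ (fun b => hE (dyadic b))) walsh_addc // walsh_lincomb.
apply: (@le_trans _ _ ((\sum_(p <- s) `|p.1|) * 2^-1 ^+ (i.+1 + j.+1))); last first.
  by rewrite -ei' -ej addnC ler_wpM2r ?half_exp_ge0 // (le_trans _ aA) // lerDr.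
rewrite mulr_suml; apply: (le_trans (ler_norm_sum _ _ _)); apply: ler_sum => p _.
by rewrite normrM ler_wpM2l //; apply: walsh_absdist_le.
Qed.

End DyadicPoints.

Lemma sum_binary_digits n k : (k < 2 ^ n)%N ->
  (\sum_(m < n) odd (k %/ 2 ^ m) * 2 ^ m = k)%N.
Proof.
elim: n k => [|n IH] k; first by rewrite expn0 ltnS leqn0 => /eqP ->; rewrite big_ord0.
move=> k_lt; rewrite big_ord_recl expn0 divn1 muln1 -[RHS]odd_double_half; congr (_ + _)%N.
have half_lt : (k./2 < 2 ^ n)%N by rewrite -divn2 ltn_divLR // mulnC -expnS.
rewrite -[in RHS](IH _ half_lt) -muln2 big_distrl /=; apply: eq_bigr => i _.
by rewrite /bump leq0n add1n expnS divnMA divn2 [(2 * _)%N]mulnC mulnA.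
Qed.

Lemma digits_bij n : bijective (fun k : 'I_(2 ^ n) => digits n k).
Proof.
apply: inj_card_bij; last by rewrite card_mx muln1 card_Fp // card_ord.
move=> k k' /colP e; apply: val_inj; rewrite /= -(sum_binary_digits (ltn_ord k)).
rewrite -[RHS](sum_binary_digits (ltn_ord k')); apply: eq_bigr => i _; congr (_ * _)%N.
by have := e i; rewrite !mxE; case: (odd _); case: (odd _).
Qed.

Section NetMean.
Variables (R : realType) (d n : nat) (C : 'I_d -> 'M['F_2]_(2 * n, n)).
Local Notation freq := {ffun 'I_d -> 'rV['F_2]_(2 * n)}.
Local Notation dyadic := (@dyadic R).
Local Notation chi := (@chi R).

Definition dmean m (h : R -> R) : R := 2^-1 ^+ m * \sum_(b : 'cV['F_2]_m) h (dyadic b).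

Lemma walsh0 m h : walsh (h \o @dyadic m) 0 = dmean m h.
Proof. by congr (_ * _); apply: eq_bigr => b _; rewrite chi0 mulr1. Qed.

Definition net_mean (F : ('I_d -> R) -> R) : R :=
  (2 ^ n)%:R^-1 * \sum_(k < 2 ^ n) F (net_coord R C k).

Lemma net_mean_walsh (h : 'I_d -> R -> R) :
  net_mean (fun x => \prod_i h i (x i))
    = \sum_(r : freq | dual C r) \prod_i walsh (h i \o @dyadic (2 * n)) (r i).
Proof.
have expand k : \prod_i h i (net_coord R C k i)
    = \sum_(r : freq) (\prod_i walsh (h i \o @dyadic (2 * n)) (r i))
        * chi (\sum_i r i *m C i) (digits n k).
  rewrite (eq_bigr _ (fun i _ => walsh_inversion (h i \o @dyadic (2 * n)) (C i *m digits n k))).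
  rewrite bigA_distr_bigA; apply: eq_bigr => r _; rewrite big_split; congr (_ * _).
  by rewrite chi_suml; apply: eq_bigr => i _; rewrite /chi mulmxA.
rewrite /net_mean (eq_bigr _ (fun (k : 'I_(2 ^ n)) _ => expand k)).
rewrite exchange_big mulr_sumr [RHS]big_mkcond; apply: eq_bigr => r _ /=.
rewrite -mulr_sumr (_ : \sum_(k < 2 ^ n) _ = \sum_b chi (\sum_i r i *m C i) b); last first.
  by rewrite [RHS](reindex _ (onW_bij _ (digits_bij n))).
rewrite sum_chi_col /dual; case: ifP => _; last by rewrite !mulr0.
by rewrite mulrC -mulrA natrX divff ?mulr1 // expf_neq0 // pnatr_eq0.
Qed.

Lemma net_mean_dist (A : R) (h : 'I_d -> R -> R) :
  (forall i (r : 'rV['F_2]_(2 * n)), `|walsh (h i \o @dyadic _) r| <= A * 2^-1 ^+ row_wt r) ->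
  `|net_mean (fun x => \prod_i h i (x i)) - \prod_i dmean (2 * n) (h i)|
    <= A ^+ d * \sum_(r : freq | dual C r && (r != 0)) 2^-1 ^+ freq_wt r.
Proof.
move=> walsh_h; rewrite net_mean_walsh (bigD1 (0 : freq)) /=; last first.
  by rewrite /dual big1 // => i _; rewrite ffunE mul0mx.
rewrite (eq_bigr (fun i => dmean (2 * n) (h i))) => [|i _]; last by rewrite ffunE walsh0.
rewrite addrC addrK mulr_sumr; apply: (le_trans (ler_norm_sum _ _ _)).
apply: ler_sum => r _; rewrite normr_prod.
have -> : A ^+ d * 2^-1 ^+ freq_wt r = \prod_(i < d) (A * 2^-1 ^+ row_wt (r i)).
  by rewrite big_split /= prodr_const card_ord -expr_sum.
by apply: ler_prod => i _; rewrite normr_ge0 walsh_h.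
Qed.

End NetMean.

(** * Smooth functions *)

Local Open Scope classical_set_scope.
Local Open Scope ring_scope.
Local Notation "f ^` ()" := (derive1 f) : ring_scope.
Local Notation "f ^` ( n )" := (derive1n n f) : ring_scope.

Section Smooth.
Variable R : realType.
Implicit Types (f g : R -> R) (x y a c e : R).

(* Every derivative of [expR (- x^-1)] is a combination of the functions [flat k]. *)
Definition flat k x : R := if x <= 0 then 0 else x^-1 ^+ k * expR (- x^-1).

Lemma flat_norm_le k x : `|flat k x| <= (k.+1)`!%:R * `|x|.
Proof.
rewrite /flat; case: (leP x 0) => [_|x_gt0]; first by rewrite normr0 mulr_ge0.
have xV_ge0 : 0 <= x^-1 by rewrite invr_ge0 ltW.
have fact_gt0 : 0 < (k.+1)`!%:R :> R by rewrite ltr0n fact_gt0.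
have exp_ge : x^-1 ^+ k.+1 <= expR x^-1 * (k.+1)`!%:R.
  by rewrite -ler_pdivrMr //; have := expR_ge1Dxn k xV_ge0; lra.
rewrite normrM !ger0_norm ?expR_ge0 ?exprn_ge0 ?(ltW x_gt0) // expRN ler_pdivrMr ?expR_gt0 //.
have := ler_wpM2l (ltW x_gt0) exp_ge; rewrite exprS mulrA divff ?gt_eqF // mul1r.
by move=> /le_trans; apply; rewrite le_eqVlt; apply/orP; left; apply/eqP; ring.
Qed.

Lemma flat_continuous_at0 k : {for 0, continuous (flat k)}.
Proof.
have flat0 : flat k 0 = 0 by rewrite /flat lexx.
apply/cvgrPdist_le => /= e e_gt0; rewrite flat0.
have fact_gt0 : 0 < (k.+1)`!%:R :> R by rewrite ltr0n fact_gt0.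
near=> x; rewrite sub0r normrN; apply: le_trans (flat_norm_le _ _) _.
rewrite mulrC -ler_pdivlMr //; near: x.
have : \forall x \near (0 : R), `|0 - x| <= e / (k.+1)`!%:R.
  by apply: (@cvgr_dist_le _ _ _ (nbhs (0 : R)) _ id) => //; rewrite divr_gt0.
by apply: filterS => x; rewrite sub0r normrN.
Unshelve. all: by end_near. Qed.

Lemma is_derive_flat k x :
  is_derive x 1 (flat k) (flat k.+2 x - k%:R * flat k.+1 x).
Proof.
have [x_lt0|x_gt0|->] := ltgtP x 0.
- have -> : flat k.+2 x - k%:R * flat k.+1 x = 0 by rewrite /flat ltW // mulr0 subr0.
  apply: (near_eq_is_derive _ (is_derive_cst (0 : R) x (1 : R))).
  by near=> z; rewrite /flat ifT // ltW //; near: z; exact: lt_nbhsl.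
- have flatE : \forall z \near x, z^-1 ^+ k * expR (- z^-1) = flat k z.
    by near=> z; rewrite /flat leNgt ifN // negbK; near: z; exact: lt_nbhsr.
  apply: (near_eq_is_derive flatE).
  have x_neq0 : x != 0 by rewrite gt_eqF.
  have dV : is_derive x 1 (fun y : R => y^-1) (- x ^- 2 *: 1).
    by apply: (is_deriveV (f := id)).
  have dexp : is_derive x 1 (expR \o - (fun y : R => y^-1)) (expR (- x^-1) * - (- x ^- 2 *: 1)).
    exact: is_derive1_comp.
  have dM := is_deriveM (is_deriveX k dV) dexp.
  have -> : (fun z : R => z^-1 ^+ k * expR (- z^-1)) =
      (fun y : R => y^-1) ^+ k * (expR \o - (fun y : R => y^-1)).
    by apply/funext => z; rewrite !fctE.
  apply: (is_derive_eq dM).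
  rewrite /flat leNgt x_gt0 /= /GRing.scale /= !fctE.
  case: k {flatE} dM => [|k] _; last by rewrite -pred_Sn !exprS; field.
  by rewrite !expr0 !mul0r !mulr0 addr0 subr0 !mulr1 !mul1r opprK mulrC exprVn.
- apply/is_derive1_caratheodory; exists (flat k.+1); split.
  + move=> z; rewrite /flat lexx !subr0; case: leP => z_gt0; first by rewrite mul0r.
    by rewrite exprS; field; rewrite gt_eqF.
  + exact: flat_continuous_at0.
  + by rewrite /flat lexx mulr0 subr0.
Unshelve. all: by end_near. Qed.

(* A class of functions that is stable under differentiation, hence consists of
   infinitely differentiable functions. *)
Inductive smooth : (R -> R) -> Prop :=
| smooth_cst a : smooth (fun=> a)
| smooth_id : smooth (fun x => x)
| smooth_flat k : smooth (flat k)
| smoothD f g : smooth f -> smooth g -> smooth (fun x => f x + g x)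
| smoothM f g : smooth f -> smooth g -> smooth (fun x => f x * g x)
| smoothV f : smooth f -> (forall x, f x != 0) -> smooth (fun x => (f x)^-1)
| smooth_rescale c e f : smooth f -> smooth (fun x => f ((x - c) / e)).

Lemma is_derive_rescale f c e x df : is_derive ((x - c) / e) 1 f df ->
  is_derive x 1 (fun x => f ((x - c) / e)) (e^-1 * df).
Proof.
move=> dfx; have daff : is_derive x 1 (fun x => (x - c) / e) e^-1.
  have -> : (fun x => (x - c) / e) = (fun x => x - c) * cst e^-1 by apply/funext.
  have dB := is_deriveB (is_derive_id x (1 : R)) (is_derive_cst c x (1 : R)).
  have := is_deriveM dB (is_derive_cst e^-1 x (1 : R)).
  by rewrite /GRing.scale /= mulr0 add0r subr0 mulr1.
by rewrite mulrC; exact: is_derive1_comp.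
Qed.

Lemma smooth_is_derive f : smooth f ->
  exists2 f', smooth f' & forall x, is_derive x 1 f (f' x).
Proof.
elim=> {f} [a||k|f g _ [f' sf' df] _ [g' sg' dg]|f g sf [f' sf' df] sg [g' sg' dg]
  |f sf [f' sf' df] nz|c e f _ [f' sf' df]].
- by exists (fun=> 0); [exact: smooth_cst|move=> x; exact: is_derive_cst].
- by exists (fun=> 1); [exact: smooth_cst|move=> x; exact: is_derive_id].
- exists (fun x => flat k.+2 x + (- k%:R) * flat k.+1 x).
    exact: smoothD (smooth_flat _) (smoothM (smooth_cst _) (smooth_flat _)).
  by move=> x; apply: is_derive_eq; [exact: is_derive_flat|rewrite mulNr].
- by exists (fun x => f' x + g' x); [exact: smoothD|move=> x; exact: is_deriveD].
- exists (fun x => f x * g' x + g x * f' x); first by apply: smoothD; apply: smoothM.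
  by move=> x; exact: is_deriveM.
- exists (fun x => -1 * ((f x)^-1 * (f x)^-1) * f' x).
    apply: smoothM => //; apply: smoothM; first exact: smooth_cst.
    by apply: smoothM; apply: smoothV.
  move=> x; apply: (is_derive_eq (is_deriveV (nz x) (df x))).
  by rewrite /GRing.scale /= mulN1r -invfM -expr2.
- exists (fun x => e^-1 * f' ((x - c) / e)); last by move=> x; exact: is_derive_rescale.
  by apply: smoothM; [exact: smooth_cst|exact: smooth_rescale].
Qed.

Lemma is_derive1_fun f g : (forall x, is_derive x 1 f (g x)) -> f^`() = g.
Proof. by move=> dfg; apply/funext => x; rewrite derive1E; apply: derive_val. Qed.

Lemma smooth_derivable f x : smooth f -> derivable f x 1.
Proof. by move=> /smooth_is_derive[f' _ /(_ x) []]. Qed.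

Lemma smooth_derive1 f : smooth f -> smooth f^`().
Proof. by move=> /smooth_is_derive[f' sf' /is_derive1_fun ->]. Qed.

Lemma smooth_derive1n n f : smooth f -> smooth f^`(n).
Proof. by move=> sf; elim: n => // n; rewrite derive1nS; apply: smooth_derive1. Qed.

Lemma smooth_continuous f : smooth f -> continuous f.
Proof.
move=> sf x; apply: differentiable_continuous; apply/derivable1_diffP.
exact: smooth_derivable.
Qed.

Lemma smooth_is_derive1 f x : smooth f -> is_derive x 1 f (f^`() x).
Proof. by move=> sf; rewrite derive1E; split => //; exact: smooth_derivable. Qed.

Lemma smoothB f g : smooth f -> smooth g -> smooth (fun x => f x - g x).
Proof.
move=> sf sg; have -> : (fun x => f x - g x) = (fun x => f x + (-1) * g x).
  by apply/funext => x; rewrite mulN1r.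
by apply: smoothD => //; apply: smoothM => //; apply: smooth_cst.
Qed.

Lemma smoothZ a f : smooth f -> smooth (fun x => a * f x).
Proof. by move=> sf; apply: smoothM => //; apply: smooth_cst. Qed.

Lemma smooth_bounded f : smooth f -> exists M, forall x, 0 <= x <= 1 -> `|f x| <= M.
Proof.
move=> sf; have cf : {within `[0, 1], continuous (fun x => `|f x|)}.
  apply: continuous_subspaceT => x; apply: continuous_comp; last exact: norm_continuous.
  exact: smooth_continuous.
have [c _ fc] := EVT_max ler01 cf; exists `|f c| => x x01; apply: fc.
by rewrite in_itv.
Qed.

Lemma derive1_eq_lt f g c x : (forall z, z < c -> f z = g z) -> x < c -> f^`() x = g^`() x.
Proof.
move=> fg xc; rewrite !derive1E; apply: near_eq_derive => //.
by near=> z; apply: fg; near: z; exact: lt_nbhsl.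
Unshelve. all: by end_near. Qed.

Lemma derive1_eq_gt f g c x : (forall z, c < z -> f z = g z) -> c < x -> f^`() x = g^`() x.
Proof.
move=> fg xc; rewrite !derive1E; apply: near_eq_derive => //.
by near=> z; apply: fg; near: z; exact: lt_nbhsr.
Unshelve. all: by end_near. Qed.

Lemma derive1_cst_fun a : (fun=> a : R)^`() = fun=> 0.
Proof. by apply: is_derive1_fun => x; apply: is_derive_cst. Qed.

Lemma derive1_id_fun : (fun x : R => x)^`() = fun=> 1.
Proof. by apply: is_derive1_fun => x; apply: is_derive_id. Qed.

Lemma derive1_smoothD f g : smooth f -> smooth g ->
  (fun x => f x + g x)^`() = fun x => f^`() x + g^`() x.
Proof.
move=> sf sg; apply: is_derive1_fun => x.
by apply: is_deriveD; apply: smooth_is_derive1.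
Qed.

Lemma derive1_smoothB f g : smooth f -> smooth g ->
  (fun x => f x - g x)^`() = fun x => f^`() x - g^`() x.
Proof.
move=> sf sg; apply: is_derive1_fun => x.
by apply: is_deriveB; apply: smooth_is_derive1.
Qed.

Lemma derive1_smoothM f g : smooth f -> smooth g ->
  (fun x => f x * g x)^`() = fun x => f x * g^`() x + g x * f^`() x.
Proof.
move=> sf sg; apply: is_derive1_fun => x.
by apply: is_deriveM; apply: smooth_is_derive1.
Qed.

Lemma derive1_subc c : (fun x : R => x - c)^`() = fun=> 1.
Proof.
rewrite derive1_smoothB ?derive1_id_fun ?derive1_cst_fun; [|exact: smooth_id|exact: smooth_cst].
by apply/funext => x; rewrite subr0.
Qed.

Lemma derive1_rescale f c e : smooth f ->
  (fun x => f ((x - c) / e))^`() = fun x => e^-1 * f^`() ((x - c) / e).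
Proof.
move=> sf; apply: is_derive1_fun => x; apply: is_derive_rescale.
exact: smooth_is_derive1.
Qed.

Definition step x : R := flat 0 x / (flat 0 x + flat 0 (1 - x)).

Lemma flat0_ge0 x : 0 <= flat 0 x.
Proof. by rewrite /flat; case: (leP x 0) => // _; rewrite expr0 mul1r expR_ge0. Qed.

Lemma flat0_gt0 x : 0 < x -> 0 < flat 0 x.
Proof. by move=> x_gt0; rewrite /flat leNgt x_gt0 /= expr0 mul1r expR_gt0. Qed.

Lemma step_denominator_gt0 x : 0 < flat 0 x + flat 0 (1 - x).
Proof.
have [x_sgn|x_sgn] := ltP 0 x; first by rewrite ltr_pwDl ?flat0_gt0 ?flat0_ge0.
by rewrite ltr_wpDl ?flat0_ge0 // flat0_gt0 // subr_gt0; lra.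
Qed.

Lemma smooth_step : smooth step.
Proof.
apply: smoothM; first exact: smooth_flat.
apply: smoothV => [|x]; last by rewrite gt_eqF // step_denominator_gt0.
apply: smoothD; first exact: smooth_flat.
have -> : (fun x => flat 0 (1 - x)) = (fun x => flat 0 ((x - 1) / -1)).
  by apply/funext => x; congr flat; field.
exact: smooth_rescale (smooth_flat _).
Qed.

Lemma step_itv x : 0 <= step x <= 1.
Proof.
rewrite /step divr_ge0 ?flat0_ge0 ?(ltW (step_denominator_gt0 _)) //=.
by rewrite ler_pdivrMr ?step_denominator_gt0 // mul1r lerDl flat0_ge0.
Qed.

Lemma rescale_le0 c e x : 0 < e -> ((x - c) / e <= 0) = (x <= c).
Proof. by move=> e_gt0; rewrite ler_pdivrMr // mul0r subr_le0. Qed.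

Lemma rescale_ge1 c e x : 0 < e -> (1 <= (x - c) / e) = (c + e <= x).
Proof. by move=> e_gt0; rewrite ler_pdivlMr // mul1r lerBrDl. Qed.

Lemma step_rescale0 c e x : 0 < e -> x <= c -> step ((x - c) / e) = 0.
Proof. by move=> e_gt0 xc; rewrite /step {1}/flat rescale_le0 // xc mul0r. Qed.

Lemma step_rescale1 c e x : 0 < e -> c + e <= x -> step ((x - c) / e) = 1.
Proof.
move=> e_gt0; rewrite -rescale_ge1 // => z_ge1.
rewrite /step [flat 0 (1 - _)]/flat subr_le0 z_ge1 addr0.
by rewrite divff // gt_eqF // flat0_gt0 // (lt_le_trans ltr01).
Qed.

End Smooth.

Section TensorSum.
Variables (R : realType) (d : nat) (I : finType).
Implicit Types (a : I -> R) (phi : I -> 'I_d -> R -> R) (y : 'rV[R]_d).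

Definition tensor_sum a phi y : R := \sum_q a q * \prod_i phi q i (y ord0 i).

Definition derive_coord (i : 'I_d) (f : 'I_d -> R -> R) : 'I_d -> R -> R :=
  fun j => if j == i then (f j)^`() else f j.

Lemma is_derive_coord_line (f : 'rV[R]_d -> R) (c : R) (g : R -> R) (i : 'I_d) y :
  smooth g -> (forall h : R, f (h *: coord_vec R i + y) = c * g (h + y ord0 i)) ->
  is_derive y (coord_vec R i) f (c * g^`() (y ord0 i)).
Proof.
move=> sg fE.
have fy : f y = c * g (y ord0 i) by have := fE 0; rewrite scale0r !add0r.
have [dg gE] := smooth_is_derive1 (y ord0 i) sg.
have lim_g : h^-1 *: ((g \o shift (y ord0 i)) (h *: 1) - g (y ord0 i)) @[h --> 0^']
    --> g^`() (y ord0 i).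
  by rewrite -gE; exact: dg.
have lim_f : h^-1 *: ((f \o shift y) (h *: coord_vec R i) - f y) @[h --> 0^']
    --> c * g^`() (y ord0 i).
  rewrite (_ : (fun h => _) =
      (fun h : R => c * (h^-1 *: ((g \o shift (y ord0 i)) (h *: 1) - g (y ord0 i))))).
    by apply: cvgM => //; exact: cvg_cst.
  by apply/funext => h /=; rewrite fE fy /GRing.scale /= mulr1; ring.
split; first by apply/cvg_ex; exists (c * g^`() (y ord0 i)).
exact: cvg_lim.
Qed.

Lemma is_derive_tensor_sum a phi i y : (forall q j, smooth (phi q j)) ->
  is_derive y (coord_vec R i) (tensor_sum a phi)
    (tensor_sum a (fun q => derive_coord i (phi q)) y).
Proof.
move=> sphi; have -> : tensor_sum a phi = \sum_q (fun y => a q * \prod_i phi q i (y ord0 i)).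
  by apply/funext => z; rewrite fct_sumE.
rewrite /tensor_sum; elim/big_ind2: _ => [|f df g dg|q _].
- exact: is_derive_cst.
- exact: is_deriveD.
rewrite (bigD1 i) //= {1}/derive_coord eqxx mulrCA [X in is_derive _ _ _ X]mulrC.
apply: is_derive_coord_line => // h; rewrite (bigD1 i) //= !mxE !eqxx mulr1 mulrCA mulrC.
congr (_ * _ * _); apply: eq_bigr => j /negbTE ji.
by rewrite /derive_coord ji !mxE ji mulr0 add0r.
Qed.

Lemma smooth_derive_coords s (f : 'I_d -> R -> R) : (forall j, smooth (f j)) ->
  forall j, smooth (foldr derive_coord f s j).
Proof.
move=> sf; elim: s => //= i s IH j; rewrite /derive_coord.
by case: eqP => // _; apply: smooth_derive1.
Qed.

Lemma iter_partial_tensor_sum a phi s : (forall q i, smooth (phi q i)) ->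
  iter_partial s (tensor_sum a phi) = tensor_sum a (fun q => foldr derive_coord (phi q) s).
Proof.
move=> sphi; elim: s => //= i s ->; apply/funext => y.
by apply: derive_val; apply: is_derive_tensor_sum => q j; apply: smooth_derive_coords.
Qed.

Lemma continuous_coord_prod (f : 'I_d -> R -> R) : (forall i, continuous (f i)) ->
  continuous (fun y : 'rV[R]_d => \prod_i f i (y ord0 i)).
Proof.
move=> cf; apply: continuous_big => [|i _ y]; first exact: mul_continuous.
by apply: continuous_comp; [exact: coord_continuous|exact: cf].
Qed.

Lemma continuous_tensor_sum a phi : (forall q i, continuous (phi q i)) ->
  continuous (tensor_sum a phi).
Proof.
move=> cphi; apply: continuous_big => [|q _ y]; first exact: add_continuous.
by apply: continuousM; [exact: cst_continuous|exact: continuous_coord_prod].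
Qed.

Lemma test_function_tensor_sum a phi (delta : R) :
  (forall q i, smooth (phi q i)) -> 0 < delta ->
  (forall q i u, u < delta \/ 1 - delta < u -> phi q i u = 0) ->
  test_function (tensor_sum a phi).
Proof.
move=> sphi delta_gt0 supp_phi; split.
  move=> s; rewrite iter_partial_tensor_sum //; split.
    by apply: continuous_tensor_sum => q i; apply/smooth_continuous/smooth_derive_coords.
  move=> i y.
  by case: (is_derive_tensor_sum a i y (fun q i => smooth_derive_coords s (sphi q) i)).
exists delta => // y [i yi]; rewrite /tensor_sum big1 // => q _.
by rewrite (bigD1 i) //= supp_phi // mul0r mulr0.
Qed.

Lemma derive_coords_twice (s : seq 'I_d) (f : 'I_d -> R -> R) j : uniq s ->
  foldr derive_coord f (flatten [seq [:: i; i] | i <- s]) j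
    = if j \in s then (f j)^`(2) else f j.
Proof.
elim: s => //= i s IH /andP[nis us]; rewrite in_cons /derive_coord.
have [ej|_] := eqVneq j i; last exact: IH.
have js : (j \in s) = false by rewrite ej (negbTE nis).
by move: (IH us); rewrite js => ->.
Qed.

Lemma mixed2_tensor_sum a phi (E : {set 'I_d}) : (forall q i, smooth (phi q i)) ->
  mixed2 E (tensor_sum a phi)
    = tensor_sum a (fun q i => if i \in E then (phi q i)^`(2) else phi q i).
Proof.
move=> sphi; rewrite /mixed2 iter_partial_tensor_sum //; apply/funext => y.
apply: eq_bigr => q _; congr (_ * _); apply: eq_bigr => i _.
by rewrite derive_coords_twice ?enum_uniq // mem_enum.
Qed.

End TensorSum.

(** * Integrals over the unit interval *)

Lemma lipschitz01_cont01 (R : realType) (c : R) (h : R -> R) :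
  lipschitz01 c h -> {within `[0%R : R, 1%R], continuous h}.
Proof.
move=> lip; apply/subspace_continuousP => u /=; rewrite in_itv /= => u01.
apply/cvgrPdist_le => omega omega_gt0; rewrite near_withinE.
apply/nbhs_ballP; exists (omega / (`|c| + 1)) => /=; first by rewrite divr_gt0 // ltr_wpDl.
move=> v; rewrite /ball /= => uv; rewrite in_itv /= => v01.
apply: le_trans (lip u v u01 v01) _.
apply: (@le_trans _ _ ((`|c| + 1) * `|u - v|)).
  by rewrite ler_wpM2r // (le_trans (ler_norm c)) // lerDl.
by rewrite mulrC -ler_pdivlMr ?ltr_wpDl // ltW.
Qed.

Lemma within_continuous_comp_sub {T U V : topologicalType} (A : set T) (B : set U)
    (f : T -> U) (g : U -> V) : {within B, continuous g} -> continuous f ->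
  (forall x, A x -> B (f x)) -> {within A, continuous (g \o f)}.
Proof.
move=> /subspace_continuousP cg cf AB; apply/subspace_continuousP => x Ax.
apply: (@cvg_comp _ _ _ f g _ (within B (nbhs (f x)))); last exact: cg _ (AB _ Ax).
move=> S BS; suff : \forall y \near within A (nbhs x), S (f y) by [].
have : \forall y \near x, B (f y) -> S (f y) by exact: cf x _ BS.
by rewrite near_withinE; apply: filterS => y BS' Ay; exact/BS'/AB.
Qed.

Section UnitIntegral.
Variable R : realType.
Implicit Types (f g h : R -> R) (u v a b e M : R).
Local Notation mu := (@lebesgue_measure R).
Local Notation I01 := `[0%R : R, 1%R]%classic.
Local Notation cont01 h := {within I01, continuous h}.

Definition int01 h : R := (\int[mu]_(u in I01) h u)%R.

Lemma cont01_integrable h : cont01 h -> mu.-integrable I01 (EFin \o h).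
Proof. by move=> ch; apply: continuous_compact_integrable => //; exact: segment_compact. Qed.

Lemma unit_interval_measure : mu I01 = 1%E.
Proof. by rewrite lebesgue_measure_itv /= lte_fin ltr01 oppr0 adde0. Qed.

Lemma EFin_int01 h : cont01 h -> (\int[mu]_(u in I01) (h u)%:E)%E = (int01 h)%:E.
Proof.
move=> /cont01_integrable ih; rewrite /int01 /Rintegral fineK //.
exact: integrable_fin_num.
Qed.

Lemma eq_int01 f g : (forall u, 0 <= u <= 1 -> f u = g u) -> int01 f = int01 g.
Proof. by move=> fg; apply: eq_Rintegral => u; rewrite inE /= in_itv /= => /fg. Qed.

Lemma cont01_cst a : cont01 (fun=> a : R).
Proof. by apply: continuous_subspaceT => u; exact: cst_continuous. Qed.

Lemma cont01_norm f : cont01 f -> cont01 (fun u => `|f u|).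
Proof. by move=> cf u; apply: continuous_comp; [exact: cf|exact: norm_continuous]. Qed.

Lemma int01_cst a : int01 (fun=> a) = a.
Proof. by rewrite /int01 Rintegral_cst //= unit_interval_measure /= mulr1. Qed.

Lemma int01D f g : cont01 f -> cont01 g -> int01 (fun u => f u + g u) = int01 f + int01 g.
Proof. by move=> cf cg; apply: RintegralD => //; exact: cont01_integrable. Qed.

Lemma int01B f g : cont01 f -> cont01 g -> int01 (fun u => f u - g u) = int01 f - int01 g.
Proof. by move=> cf cg; apply: RintegralB => //; exact: cont01_integrable. Qed.

Lemma int01Z a f : cont01 f -> int01 (fun u => a * f u) = a * int01 f.
Proof. by move=> cf; apply: RintegralZl => //; exact: cont01_integrable. Qed.

Lemma int01_norm_le f g : cont01 f -> cont01 g -> (forall u, 0 <= u <= 1 -> `|f u| <= g u) ->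
  `|int01 f| <= int01 g.
Proof.
move=> cf cg fg; apply: le_trans (le_normr_Rintegral _ (cont01_integrable cf)) _ => //.
by apply: le_Rintegral => //; apply: cont01_integrable => //; exact: cont01_norm.
Qed.

Lemma int01_le_cst f M : cont01 f -> (forall u, 0 <= u <= 1 -> `|f u| <= M) -> `|int01 f| <= M.
Proof.
by move=> cf fM; rewrite -[leRHS](int01_cst M); apply: int01_norm_le => //; exact: cont01_cst.
Qed.

Lemma int01_supported_le f a b M : 0 <= a -> a <= b -> b <= 1 -> cont01 f ->
  (forall u, 0 <= u <= 1 -> ~~ (a <= u <= b) -> f u = 0) ->
  (forall u, a <= u <= b -> f u <= M) -> int01 f <= M * (b - a).
Proof.
move=> a_ge0 ab b_le1 cf f_out fM.
have sub : `[a, b]%classic `<=` I01.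
  by move=> u /=; rewrite !in_itv /= => /andP[au ub]; apply/andP; split; lra.
have muab : mu `[a, b]%classic = (b - a)%:E.
  by rewrite lebesgue_measure_itv /= lte_fin; case: ltgtP ab => // -> _; rewrite subrr.
have -> : int01 f = (\int[mu]_(u in `[a, b]) f u)%R.
  rewrite -[in RHS](setIidr sub) Rintegral_mkcondr; apply: eq_int01 => u u01.
  rewrite patchE; case: ifPn => // u_notin; rewrite f_out //.
  by move: u_notin; apply: contraNN => uab; rewrite inE /= in_itv.
have if_ab : mu.-integrable `[a, b]%classic (EFin \o f).
  exact: integrableS (cont01_integrable cf).
have iM : mu.-integrable `[a, b]%classic (EFin \o (fun=> M : R)).
  exact: integrableS (cont01_integrable (@cont01_cst M)).
have <- : (\int[mu]_(_ in `[a, b]) M)%R = M * (b - a) by rewrite Rintegral_cst //= muab.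
by apply: le_Rintegral => // u; rewrite /= in_itv; apply: fM.
Qed.

Lemma int01_derive1 f : smooth f -> int01 f^`() = f 1 - f 0.
Proof.
move=> sf; have cf := smooth_continuous sf.
have cf' : cont01 f^`() by apply/continuous_subspaceT/smooth_continuous/smooth_derive1.
apply: EFin_inj; rewrite -EFin_int01 // EFinB; apply: continuous_FTC2 => //.
split; first by move=> u _; exact: smooth_derivable.
- by apply: cvg_at_right_filter; exact: cf.
- by apply: cvg_at_left_filter; exact: cf.
Qed.

Lemma is_derive_affine a b u : is_derive u 1 (fun v : R => a + b * v) b.
Proof.
have := is_deriveD (is_derive_cst a u (1 : R)) (is_deriveZ b (is_derive_id u (1 : R))).
by rewrite /GRing.scale /= mulr1 add0r.
Qed.

Lemma continuous_affine a b : continuous (fun v : R => a + b * v).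
Proof.
move=> u; apply: differentiable_continuous; apply/derivable1_diffP.
by have [] := is_derive_affine a b u.
Qed.

Lemma Rintegral_affine h a b : a < b -> {within `[a, b], continuous h} ->
  (\int[mu]_(u in `[a, b]) h u)%R = (b - a) * int01 (fun u => h (a + (b - a) * u)).
Proof.
move=> ab ch; have ba : 0 < b - a by rewrite subr_gt0.
have dF : (fun u => a + (b - a) * u)^`() = fun=> b - a.
  by apply: is_derive1_fun => u; apply: is_derive_affine.
have affine0 : a + (b - a) * 0 = a by rewrite mulr0 addr0.
have affine1 : a + (b - a) * 1 = b by rewrite mulr1 addrC subrK.
have caff : cont01 (fun u => h (a + (b - a) * u)).
  apply: (within_continuous_comp_sub ch) => [|u]; first exact: continuous_affine.
  rewrite /= !in_itv /= => /andP[u_ge0 u_le1].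
  have := mulr_ge0 (ltW ba) u_ge0; have := ler_wpM2l (ltW ba) u_le1.
  by rewrite mulr1; lra.
have subst_h := @integration_by_substitution_increasing R (fun u => a + (b - a) * u) h 0 1 ler01.
rewrite affine0 affine1 dF in subst_h; rewrite -int01Z //; congr fine; rewrite subst_h //.
- by apply: eq_integral => u _; rewrite /= mulrC.
- by move=> x y _ _ xy; rewrite ltrD2l ltr_pM2l.
- by move=> u _; exact: cst_continuous.
- exact: is_cvg_cst.
- exact: is_cvg_cst.
split; first by move=> u _; case: (is_derive_affine a (b - a) u).
- by apply: cvg_at_right_filter; exact: continuous_affine.
- by apply: cvg_at_left_filter; exact: continuous_affine.
Qed.

Lemma cont01_comp h (k : R -> R) : cont01 h -> continuous k ->
  (forall u, 0 <= u <= 1 -> 0 <= k u <= 1) -> cont01 (h \o k).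
Proof.
move=> ch ck k01; apply: (within_continuous_comp_sub ch ck) => u.
by rewrite /= !in_itv; apply: k01.
Qed.

Lemma int01_split h : cont01 h ->
  int01 h = (int01 (fun u => h (u / 2)) + int01 (fun u => h ((1 + u) / 2))) / 2.
Proof.
move=> ch; have sub a b : 0 <= a -> b <= 1 -> `[a, b]%classic `<=` I01.
  by move=> a_ge0 b_le1 u /=; rewrite !in_itv /= => /andP[au ub]; apply/andP; split; lra.
have chab a b : 0 <= a -> b <= 1 -> {within `[a, b], continuous h}.
  by move=> a_ge0 b_le1; apply: continuous_subspaceW ch; apply: sub.
have half01 : 0 < (2^-1 : R) < 1 by apply/andP; split; lra.
have -> : int01 h = (\int[mu]_(u in `[0%R, 2^-1%R]) h u)%R + (\int[mu]_(u in `[2^-1%R, 1%R]) h u)%R.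
  rewrite -(@Rintegral_itv_obnd_cbnd _ 2^-1); last first.
    apply: integrableS (cont01_integrable ch) => // u /=.
    by rewrite !in_itv /= => /andP[u_ge0 u_le1]; apply/andP; split; lra.
  rewrite -(@Rintegral_itvB _ _ (BLeft 0) (BRight 1)) ?bnd_simp; try lra.
    by rewrite addrC subrK.
  exact: cont01_integrable.
rewrite !Rintegral_affine; [|by lra|by apply: chab; lra|by lra|by apply: chab; lra].
rewrite [RHS]mulrDl; congr (_ + _).
  by rewrite subr0 mulrC; congr (_ * _); apply: eq_int01 => u _; congr h; field.
rewrite mulrC; congr (_ * _); last by field.
by apply: eq_int01 => u _; congr h; field.
Qed.

Definition tent u : R := `|2 * u - 1|.

Lemma tent_itv u : 0 <= u <= 1 -> 0 <= tent u <= 1.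
Proof. by move=> u01; rewrite /tent normr_ge0 ler_norml; lra. Qed.

Lemma continuous_tent : continuous tent.
Proof.
have -> : tent = Num.norm \o (fun u => -1 + 2 * u).
  by apply/funext => u; rewrite /tent /= addrC.
by move=> u; apply: continuous_comp; [exact: continuous_affine|exact: norm_continuous].
Qed.

Lemma int01_reflect h : cont01 h -> int01 (fun u => h (1 - u)) = int01 h.
Proof.
move=> ch; have i11 : 0 <= (1 : R) <= 1 by rewrite ler01 lexx.
by rewrite /int01 -{1}(subrr 1); exact: esym (Rintegration_by_substitution_onem i11 ch).
Qed.

Lemma int01_tent h : cont01 h -> int01 (h \o tent) = int01 h.
Proof.
move=> ch; rewrite int01_split; last exact: cont01_comp continuous_tent tent_itv.
rewrite (@eq_int01 _ (fun u => h (1 - u))) => [|u u01]; last first.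
  rewrite /= /tent; congr h; have -> : 2 * (u / 2) - 1 = u - 1 by field.
  by rewrite ler0_norm; lra.
rewrite int01_reflect // (@eq_int01 (fun u => (h \o tent) ((1 + u) / 2)) h) => [|u u01].
  by field.
rewrite /= /tent; congr h; have -> : 2 * ((1 + u) / 2) - 1 = u by field.
by rewrite ger0_norm; lra.
Qed.

Lemma dmean_split m h :
  dmean m.+1 h = (dmean m (fun u => h (u / 2)) + dmean m (fun u => h ((1 + u) / 2))) / 2.
Proof.
have := @walsh_recl R h m 0.
have rsubmx0 : rsubmx (0 : 'rV['F_2]_(1 + m)) = 0 by apply/rowP => j; rewrite !mxE.
by rewrite rsubmx0 mxE sgn0 mul1r !walsh0.
Qed.

Lemma dmean_int01_dist h m omega : cont01 h ->
  (forall u v, 0 <= u <= 1 -> 0 <= v <= 1 -> `|u - v| <= 2^-1 ^+ m -> `|h u - h v| <= omega) ->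
  `|dmean m h - int01 h| <= omega.
Proof.
elim: m h => [|m IH] h ch h_omega.
  have -> : dmean 0 h = h 0.
    rewrite /dmean expr0 mul1r (eq_bigr (fun=> h 0)) => [|b _]; last by rewrite /dyadic big_ord0.
    by rewrite sumr_const card_mx muln1 expn0.
  rewrite -{1}[h 0]int01_cst -int01B //; last exact: cont01_cst.
  apply: int01_le_cst => [|u u01].
    by apply: within_continuousB => //; exact: cont01_cst.
  by apply: h_omega => //; rewrite ?lexx ?ler01 // sub0r normrN ger0_norm ?expr0; lra.
have half01 u : 0 <= u <= 1 -> 0 <= u / 2 <= 1 by lra.
have half01_shift u : 0 <= u <= 1 -> 0 <= (1 + u) / 2 <= 1 by lra.
have halve (k : R -> R) : (forall u v, k u - k v = (u - v) / 2) ->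
    (forall u, 0 <= u <= 1 -> 0 <= k u <= 1) -> continuous k ->
    `|dmean m (h \o k) - int01 (h \o k)| <= omega.
  move=> kB k01 ck; apply: IH => [|u v u01 v01 uv]; first exact: cont01_comp.
  apply: h_omega; try exact: k01.
  by rewrite kB normrM exprS [`|2^-1|]ger0_norm ?invr_ge0 // mulrC ler_wpM2l ?invr_ge0.
rewrite dmean_split int01_split //.
have dist_half : `|dmean m (fun u => h (u / 2)) - int01 (fun u => h (u / 2))| <= omega.
  apply: (halve (fun u => u / 2)) => [u v||u] //; first by field.
  by apply: cvgMl; exact: cvg_id.
have dist_half_shift :
    `|dmean m (fun u => h ((1 + u) / 2)) - int01 (fun u => h ((1 + u) / 2))| <= omega.
  apply: (halve (fun u => (1 + u) / 2)) => [u v||u] //; first by field.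
  by apply: cvgMl; apply: cvgD; [exact: cvg_cst|exact: cvg_id].
move: dist_half dist_half_shift; set x := dmean m _; set y := int01 _.
set x' := dmean m _; set y' := int01 _ => dist dist'.
have -> : (x + x') / 2 - (y + y') / 2 = ((x - y) + (x' - y')) / 2 by field.
rewrite normrM [`|2^-1|]ger0_norm ?invr_ge0 // ler_pdivrMr //.
by have := ler_normD (x - y) (x' - y'); lra.
Qed.

Lemma dmean_dist_le m f g e :
  (forall u, 0 <= u <= 1 -> `|f u - g u| <= e) -> `|dmean m f - dmean m g| <= e.
Proof.
move=> fg; rewrite -!walsh0 -walshB; apply: walsh_norm_le => b; apply: fg.
exact: dyadic_itv.
Qed.

End UnitIntegral.

(** * Iterated integrals over the cube *)

Section Cube.
Variables (R : realType) (d : nat).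
Implicit Types (x y : 'rV[R]_d) (F G : 'rV[R]_d -> R) (h : R -> R).
Implicit Types (a delta omega : R) (s : seq 'I_d).
Local Notation cube := (@unit_cube R d).
Local Notation cont01 h := {within `[0%R : R, 1%R], continuous h}.

Definition modulus F delta omega : Prop :=
  forall x y, cube x -> cube y -> (forall i, `|x ord0 i - y ord0 i| <= delta) ->
    `|F x - F y| <= omega.

Definition ucont F : Prop :=
  forall omega, 0 < omega -> exists2 delta, 0 < delta & modulus F delta omega.

Lemma cube0 : cube 0.
Proof. by move=> i; rewrite mxE lexx ler01. Qed.

Lemma cube_set_coord x i u : cube x -> 0 <= u <= 1 -> cube (set_coord x i u).
Proof. by move=> cx u01 j; rewrite mxE; case: eqP. Qed.

Lemma compact_cube : compact cube.
Proof.
have -> : cube = [set v : 'rV[R]_d | forall i, `[0%R : R, 1%R]%classic (v ord0 i)].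
  by apply/seteqP; split=> v /= h i; have := h i; rewrite /= in_itv.
by apply: (@rV_compact R d (fun=> `[0%R : R, 1%R]%classic)) => i; apply: segment_compact.
Qed.

Lemma within_continuous_ucont F : {within cube, continuous F} -> ucont F.
Proof.
move=> /subspace_continuousP cF omega omega_gt0.
pose P (delta : R) x := cube x -> forall y, cube y ->
  (forall i, `|x ord0 i - y ord0 i| <= delta) -> `|F x - F y| <= omega.
have := (compact_near_coveringP cube).1 compact_cube R ((0 : R)^'+) P _.
case=> [x cx|].
  have /cvgrPdist_lt /(_ (omega / 2)) := cF x cx; rewrite divr_gt0 // => /(_ isT).
  rewrite near_withinE => /nbhs_ballP[r /= r_gt0 ball_r].
  have r2_gt0 : 0 < r / 2 by rewrite divr_gt0.
  exists (ball x (r / 2), [set t : R | t < r / 2]) => /=.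
    by split; [exact: nbhsx_ballx|exact: nbhs_right_lt].
  move=> [x' t] /= [x'_ball t_lt] cx' y cy xy.
  have close z : cube z -> (forall i, `|x' ord0 i - z ord0 i| <= t \/ x' = z) ->
      `|F x - F z| < omega / 2.
    move=> cz x'z; apply: (ball_r z) => //; split=> // i j; rewrite (ord1 i).
    have := x'_ball.2 ord0 j; rewrite /ball /= => xx'.
    have [x'z_le|<-] := x'z j; last by apply: lt_trans xx' _; lra.
    rewrite (le_lt_trans (ler_distD (x' ord0 j) _ _)) // [ltRHS]splitr ltr_leD //.
    exact: le_trans x'z_le (ltW t_lt).
  have close_x' := close x' cx' (fun i => or_intror erefl).
  have close_y := close y cy (fun i => or_introl (xy i)).
  by have := ler_distD (F x) (F x') (F y); rewrite [`|F x' - F x|]distrC; lra.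
move=> r /= r_gt0 unif; exists (r / 2); first by rewrite divr_gt0.
move=> x y cx cy xy; apply: (unif (r / 2)) => //=; last by rewrite divr_gt0.
by rewrite sub0r normrN ger0_norm; lra.
Qed.

Lemma continuous_ucont F : continuous F -> ucont F.
Proof. by move=> cF; apply/within_continuous_ucont/continuous_subspaceT. Qed.

Lemma lipschitz_ucont F c : 0 <= c -> (forall delta, 0 <= delta -> modulus F delta (c * delta)) ->
  ucont F.
Proof.
move=> c_ge0 mF omega omega_gt0.
have delta_gt0 : 0 < omega / (c + 1) by rewrite divr_gt0 // ltr_wpDl.
exists (omega / (c + 1)) => // x y cx cy xy; apply: le_trans (mF _ (ltW delta_gt0) x y cx cy xy) _.
by rewrite mulrCA ger_pMr // ler_pdivrMr ?ltr_wpDl // mul1r lerDl.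
Qed.

Lemma ucont_slice F x i : ucont F -> cube x -> cont01 (fun u => F (set_coord x i u)).
Proof.
move=> uF cx; apply/subspace_continuousP => u /=; rewrite in_itv /= => u01.
apply/cvgrPdist_le => omega omega_gt0; have [delta delta_gt0 mF] := uF omega omega_gt0.
rewrite near_withinE; apply/nbhs_ballP; exists delta => //= v; rewrite /ball /= => uv.
rewrite in_itv /= => v01; apply: mF; try exact: cube_set_coord.
by move=> j; rewrite !mxE; case: eqP => // _; rewrite ?subrr ?normr0 ltW.
Qed.

Fixpoint iter_coord (J : (R -> R) -> R) s F x : R :=
  if s is i :: s' then J (fun u => iter_coord J s' F (set_coord x i u)) else F x.

Definition riint := iter_coord (@int01 R).

Lemma modulus_int01 F i delta omega : ucont F -> modulus F delta omega ->
  modulus (fun x => int01 (fun u => F (set_coord x i u))) delta omega.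
Proof.
move=> uF mF x y cx cy xy; rewrite -int01B; try exact: ucont_slice.
apply: int01_le_cst; first by apply: within_continuousB; exact: ucont_slice.
move=> u u01; apply: mF; try exact: cube_set_coord.
move=> j; rewrite !mxE; case: eqP => // _; rewrite subrr normr0.
exact: le_trans (normr_ge0 _) (xy j).
Qed.

Lemma ucont_riint s F : ucont F -> ucont (riint s F).
Proof.
move=> uF; elim: s => //= i s IH omega /IH[delta delta_gt0 m].
by exists delta => //; apply: modulus_int01.
Qed.

Lemma modulus_riint s F delta omega : ucont F -> modulus F delta omega ->
  modulus (riint s F) delta omega.
Proof.
by move=> uF mF; elim: s => //= i s IH; apply: modulus_int01 => //; apply: ucont_riint.
Qed.

Lemma ucont_riint_slice s F x i : ucont F -> cube x ->
  cont01 (fun u => riint s F (set_coord x i u)).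
Proof. by move=> uF; apply/ucont_slice/ucont_riint. Qed.

Lemma EFin_riint s F x : ucont F -> cube x ->
  iint_rec s (fun y => (F y)%:E) x = (riint s F x)%:E.
Proof.
move=> uF; elim: s x => //= i s IH x cx.
rewrite -[RHS]EFin_int01; last exact: ucont_riint_slice.
by apply: eq_integral => u; rewrite inE /= in_itv /= => u01; apply/IH/cube_set_coord.
Qed.

Lemma eq_riint s F G x : cube x -> (forall y, cube y -> F y = G y) -> riint s F x = riint s G x.
Proof.
move=> + FG; elim: s x => [|i s IH] x cx /=; first exact: FG.
by apply: eq_int01 => u u01; apply/IH/cube_set_coord.
Qed.

Lemma riintD s F G x : ucont F -> ucont G -> cube x ->
  riint s (fun y => F y + G y) x = riint s F x + riint s G x.
Proof.
move=> uF uG; elim: s x => //= i s IH x cx.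
rewrite -[RHS]int01D; try exact: ucont_riint_slice.
by apply: eq_int01 => u u01; apply/IH/cube_set_coord.
Qed.

Lemma ucontZ a F : ucont F -> ucont (fun y => a * F y).
Proof.
move=> uF omega omega_gt0; have a1_gt0 : 0 < `|a| + 1 by rewrite ltr_wpDl.
have [|delta delta_gt0 mF] := uF (omega / (`|a| + 1)); first by rewrite divr_gt0.
exists delta => // x y cx cy xy; rewrite -mulrBr normrM.
apply: le_trans (ler_wpM2l (normr_ge0 a) (mF x y cx cy xy)) _.
by rewrite mulrCA ger_pMr // ler_pdivrMr // mul1r lerDl.
Qed.

Lemma riintZ s a F x : ucont F -> cube x -> riint s (fun y => a * F y) x = a * riint s F x.
Proof.
move=> uF; elim: s x => //= i s IH x cx.
rewrite -[RHS]int01Z; last exact: ucont_riint_slice.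
by apply: eq_int01 => u u01; apply/IH/cube_set_coord.
Qed.

Lemma ucont_cst a : ucont (fun=> a).
Proof.
move=> omega omega_gt0; exists 1 => // x y _ _ _.
by rewrite subrr normr0 ltW.
Qed.

Lemma ucontD F G : ucont F -> ucont G -> ucont (fun y => F y + G y).
Proof.
move=> uF uG omega omega_gt0; have omega2_gt0 : 0 < omega / 2 by rewrite divr_gt0.
have [deltaF deltaF_gt0 mF] := uF _ omega2_gt0; have [deltaG deltaG_gt0 mG] := uG _ omega2_gt0.
exists (Num.min deltaF deltaG); first by rewrite lt_min deltaF_gt0.
move=> x y cx cy xy; rewrite opprD addrACA (le_trans (ler_normD _ _)) // [leRHS]splitr lerD //.
  by apply: mF => // i; apply: le_trans (xy i) _; rewrite ge_min lexx.
by apply: mG => // i; apply: le_trans (xy i) _; rewrite ge_min lexx orbT.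
Qed.

Lemma ucont_sum (I : Type) (r : seq I) (F : I -> 'rV[R]_d -> R) :
  (forall q, ucont (F q)) -> ucont (fun y => \sum_(q <- r) F q y).
Proof.
move=> uF; elim: r => [|q r IH].
  by under eq_fun do rewrite big_nil; exact: ucont_cst.
by under eq_fun do rewrite big_cons; apply: ucontD.
Qed.

Lemma riint_sum (I : Type) (r : seq I) s (F : I -> 'rV[R]_d -> R) x :
  (forall q, ucont (F q)) -> cube x ->
  riint s (fun y => \sum_(q <- r) F q y) x = \sum_(q <- r) riint s (F q) x.
Proof.
move=> uF cx; elim: r => [|q r IH].
  rewrite big_nil -[RHS](mul0r (riint s (fun=> 0) x)) -riintZ //; last exact: ucont_cst.
  by apply: eq_riint => // y _; rewrite big_nil mul0r.
rewrite big_cons -IH -riintD //; last exact: ucont_sum.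
by apply: eq_riint => // y _; rewrite big_cons.
Qed.

Lemma riint_norm_le s F G x : ucont F -> ucont G -> (forall y, cube y -> `|F y| <= G y) ->
  cube x -> `|riint s F x| <= riint s G x.
Proof.
move=> uF uG FG; elim: s x => [|i s IH] x cx /=; first exact: FG.
apply: int01_norm_le; try exact: ucont_riint_slice.
by move=> u u01; apply/IH/cube_set_coord.
Qed.

Lemma riint_prod s (h : 'I_d -> R -> R) x : uniq s -> (forall i, cont01 (h i)) -> cube x ->
  riint s (fun y => \prod_i h i (y ord0 i)) x
    = \prod_i (if i \in s then int01 (h i) else h i (x ord0 i)).
Proof.
move=> + ch; elim: s x => [|i s IH] x //= /andP[nis us] cx.
pose c := \prod_(j | j != i) (if j \in s then int01 (h j) else h j (x ord0 j)).
transitivity (int01 (fun u => c * h i u)).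
  apply: eq_int01 => u u01; rewrite -[LHS]/(riint s _ _) IH //; last exact: cube_set_coord.
  rewrite (bigD1 i) //= (negbTE nis) mxE eqxx mulrC; congr (_ * _).
  by apply: eq_bigr => j /negbTE ji; rewrite mxE ji.
rewrite int01Z // [RHS](bigD1 i) //= mem_head mulrC; congr (_ * _).
by apply: eq_bigr => j /negbTE ji; rewrite in_cons ji.
Qed.

Lemma riint_coord_prod (h : 'I_d -> R -> R) : (forall i, cont01 (h i)) ->
  riint (enum 'I_d) (fun y => \prod_i h i (y ord0 i)) 0 = \prod_i int01 (h i).
Proof.
move=> ch; rewrite riint_prod ?enum_uniq //; last exact: cube0.
by apply: eq_bigr => i _; rewrite mem_enum.
Qed.

(* Since the weights have integral 1, the difference is the integral of [F y - F x]
   against their product. *)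
Lemma riint_mollify_dist F (w : 'I_d -> R -> R) x delta omega A :
  {within cube, continuous F} -> cube x -> 0 <= omega -> modulus F delta omega ->
  (forall i, continuous (w i)) -> (forall i, int01 (w i) = 1) ->
  (forall i, int01 (fun u => `|w i u|) <= A) ->
  (forall i u, 0 <= u <= 1 -> w i u != 0 -> `|u - x ord0 i| <= delta) ->
  `|riint (enum 'I_d) (fun y => F y * \prod_i w i (y ord0 i)) 0 - F x| <= omega * A ^+ d.
Proof.
move=> cF cx omega_ge0 mF cw int_w int_norm_w w_supp; have cube_0 := cube0.
have cnw i : continuous (fun u => `|w i u|).
  by move=> u; apply: continuous_comp; [exact: cw|exact: norm_continuous].
have uw := continuous_ucont (continuous_coord_prod cw).
have unw := continuous_ucont (continuous_coord_prod cnw).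
have uFw : ucont (fun y => F y * \prod_i w i (y ord0 i)).
  apply: within_continuous_ucont => y; apply: continuousM; first exact: cF.
  exact: (continuous_subspaceT (continuous_coord_prod cw)).
have cw01 i : cont01 (w i) by apply: continuous_subspaceT.
have cnw01 i : cont01 (fun u => `|w i u|) by apply: continuous_subspaceT.
have FxE : - F x = riint (enum 'I_d) (fun y => - F x * \prod_i w i (y ord0 i)) 0.
  by rewrite riintZ // riint_coord_prod // big1 ?mulr1.
rewrite FxE -riintD //; last exact: ucontZ.
apply: (@le_trans _ _ (riint (enum 'I_d) (fun y => omega * \prod_i `|w i (y ord0 i)|) 0)).
  apply: riint_norm_le => [|| y cy |//]; [by apply: ucontD => //; exact: ucontZ|exact: ucontZ|].
  rewrite -mulrDl normrM normr_prod.
  have [/existsP[i /eqP w_eq0]|/existsPn w_neq0] := boolP [exists i, w i (y ord0 i) == 0].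
    by rewrite (bigD1 i) //= w_eq0 normr0 mul0r !mulr0.
  apply: ler_wpM2r; first exact: prodr_ge0.
  by apply: mF => // i; apply: w_supp => //; exact: cy.
rewrite riintZ // (riint_coord_prod cnw01) ler_wpM2l // -[X in A ^+ X]card_ord -prodr_const.
by apply: ler_prod => i _; rewrite int_norm_w andbT; apply: Rintegral_ge0.
Qed.

Definition dmean_iter m := iter_coord (@dmean R m).

Lemma dmean_iter_dist m s F omega x : ucont F -> modulus F (2^-1 ^+ m) omega -> cube x ->
  `|dmean_iter m s F x - riint s F x| <= (size s)%:R * omega.
Proof.
move=> uF mF; elim: s x => [|i s IH] x cx /=; first by rewrite subrr normr0 mul0r.
pose f u := riint s F (set_coord x i u); pose g u := dmean_iter m s F (set_coord x i u).
have dist_int : `|dmean m f - int01 f| <= omega.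
  apply: dmean_int01_dist => [|u v u01 v01 uv]; first exact: ucont_riint_slice.
  apply: (modulus_riint s uF mF); try exact: cube_set_coord.
  move=> j; rewrite !mxE; case: eqP => // _; rewrite subrr normr0; exact: half_exp_ge0.
have dist_rec : `|dmean m g - dmean m f| <= (size s)%:R * omega.
  by apply: dmean_dist_le => u u01; apply/IH/cube_set_coord.
rewrite -[X in `|X|](subrKA (dmean m f)); apply: (le_trans (ler_normD _ _)).
by rewrite -natr1 mulrDl mul1r lerD.
Qed.

Lemma dmean_iter_points m s : exists (I : finType) (a : I -> R) (p : 'rV[R]_d -> I -> 'rV[R]_d),
  (forall x q, cube x -> cube (p x q)) /\
  forall F x, dmean_iter m s F x = \sum_q a q * F (p x q).
Proof.
elim: s => [|i s [I [a [p [cp pE]]]]].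
  exists unit, (fun=> 1), (fun x _ => x); split=> // F x.
  by rewrite (big_pred1 tt) ?mul1r // => -[].
exists ('cV['F_2]_m * I)%type, (fun bq => 2^-1 ^+ m * a bq.2),
  (fun x bq => p (set_coord x i (dyadic R bq.1)) bq.2); split=> [x [b q] cx|F x] /=.
  by apply/cp/cube_set_coord => //; exact: dyadic_itv.
rewrite -(pair_bigA _ (fun b q => 2^-1 ^+ m * a q * F (p (set_coord x i (dyadic R b)) q))) /=.
rewrite -[LHS]/(dmean m (fun u => dmean_iter m s F (set_coord x i u))) /dmean mulr_sumr.
apply: eq_bigr => b _; rewrite pE mulr_sumr.
by apply: eq_bigr => q _; rewrite mulrA.
Qed.

End Cube.

Section IntegralComparison.
Context {disp : measure_display} {T : measurableType disp} {R : realType}.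
Variables (mu : {measure set T -> \bar R}) (D : set T).
Implicit Types f k : T -> \bar R.
Local Open Scope ereal_scope.

(* Neither function needs to be measurable: the integral of a nonnegative function is
   a supremum over the simple functions below it. *)
Lemma le_integral_nomeas f k : (forall u, D u -> 0 <= f u <= k u) ->
  \int[mu]_(u in D) f u <= \int[mu]_(u in D) k u.
Proof.
move=> fk; rewrite integral_mkcond [leRHS]integral_mkcond.
rewrite !ge0_integralTE; last 2 first.
- by move=> u; rewrite patchE; case: ifPn => // /set_mem/fk/andP[f_ge0 fk']; exact: le_trans fk'.
- by move=> u; rewrite patchE; case: ifPn => // /set_mem/fk/andP[].
apply: le_ereal_sup => _ [h hf <-]; exists h => // u; apply: le_trans (hf u) _.
by rewrite !patchE; case: ifPn => // /set_mem/fk/andP[].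
Qed.

Lemma abse_integral_le_nomeas f k : (forall u, D u -> `|f u| <= k u) ->
  `|\int[mu]_(u in D) f u| <= \int[mu]_(u in D) k u.
Proof.
move=> fk; rewrite integralE.
have pos_le : \int[mu]_(u in D) f^\+ u <= \int[mu]_(u in D) k u.
  apply: le_integral_nomeas => u /fk fku; rewrite funepos_ge0 /= funeposE.
  by apply: le_trans fku; rewrite ge_max abse_ge0 lee_abs.
have neg_le : \int[mu]_(u in D) f^\- u <= \int[mu]_(u in D) k u.
  apply: le_integral_nomeas => u /fk fku; rewrite funeneg_ge0 /= funenegE.
  by apply: le_trans fku; rewrite ge_max abse_ge0 -abseN lee_abs.
have pos_ge0 : 0 <= \int[mu]_(u in D) f^\+ u by apply: integral_ge0 => u _; exact: funepos_ge0.
have neg_ge0 : 0 <= \int[mu]_(u in D) f^\- u by apply: integral_ge0 => u _; exact: funeneg_ge0.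
move: pos_ge0 neg_ge0 pos_le neg_le.
move: (\int[mu]_(u in D) f^\+ u) (\int[mu]_(u in D) f^\- u) (\int[mu]_(u in D) k u).
move=> [p| |] [q| |] [K| |] //=; rewrite ?leey // !lee_fin => p_ge0 q_ge0 pK qK.
by rewrite ler_norml; apply/andP; split; lra.
Qed.

End IntegralComparison.

Section IteratedIntegral.
Variables (R : realType) (d : nat).
Implicit Types (g : 'rV[R]_d -> \bar R) (s : seq 'I_d) (x : 'rV[R]_d).
Local Notation mu := (@lebesgue_measure R).
Local Notation cube := (@unit_cube R d).
Local Notation I01 := `[0%R : R, 1%R]%classic.
Local Open Scope ereal_scope.

Lemma abse_iint_rec_le s f g x : (forall y, cube y -> `|f y| <= g y) -> cube x ->
  `|iint_rec s f x| <= iint_rec s g x.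
Proof.
move=> fg; elim: s x => [|i s IH] x cx /=; first exact: fg.
apply: abse_integral_le_nomeas => u; rewrite /= in_itv /= => u01.
by apply/IH/cube_set_coord.
Qed.

Definition measurable_rV g : Prop := measurable_fun [set: d.-tuple R] (g \o @rv_of_tuple R d).

Definition set_tuple (t : d.-tuple R) (i : 'I_d) (u : R) : d.-tuple R :=
  [tuple if j == i then u else tnth t j | j < d].

Lemma set_coord_rv_of_tuple t i u :
  set_coord (rv_of_tuple t) i u = rv_of_tuple (set_tuple t i u).
Proof. by apply/rowP => j; rewrite !mxE tnth_mktuple. Qed.

Lemma measurable_set_tuple i :
  measurable_fun [set: d.-tuple R * R] (fun p => set_tuple p.1 i p.2).
Proof.
apply/measurable_fun_tnthP => j /=.
rewrite (_ : _ \o _ = (fun p : d.-tuple R * R => if j == i then p.2 else tnth p.1 j)); last first.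
  by apply/funext => p /=; rewrite tnth_mktuple.
case: eqP => _; first exact: measurable_snd.
apply: (@measurableT_comp _ _ _ _ _ _ (fun t : d.-tuple R => tnth t j) setT (@fst (d.-tuple R) R)).
  exact: measurable_tnth.
exact: measurable_fst.
Qed.

Lemma measurable_slice g x i : measurable_rV g ->
  measurable_fun [set: R] (fun u => g (set_coord x i u)).
Proof.
move=> mg; pose t := [tuple x ord0 j | j < d].
have xt : x = rv_of_tuple t by apply/rowP => j; rewrite mxE tnth_mktuple.
rewrite (_ : (fun u => _) = (g \o @rv_of_tuple R d) \o (fun u => set_tuple t i u)); last first.
  by apply/funext => u /=; rewrite xt set_coord_rv_of_tuple.
apply: (measurableT_comp mg).
apply: (@measurableT_comp _ _ _ _ _ _ (fun p : d.-tuple R * R => set_tuple p.1 i p.2) setT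
  (fun u : R => (t, u))); first exact: measurable_set_tuple.
by apply: measurable_fun_pair => //; exact: measurable_cst.
Qed.

Lemma measurable_rV_integral g i : measurable_rV g -> (forall y, 0 <= g y) ->
  measurable_rV (fun x => \int[mu]_(u in I01) g (set_coord x i u)).
Proof.
move=> mg g_ge0.
pose f (p : d.-tuple R * R) := (g \o @rv_of_tuple R d) (set_tuple p.1 i p.2) * (\1_I01 p.2)%:E.
have mf : measurable_fun [set: d.-tuple R * R] f.
  apply: emeasurable_funM; first exact: (measurableT_comp mg (measurable_set_tuple i)).
  apply/measurable_EFinP.
  apply: (@measurableT_comp _ _ _ _ _ _ (\1_I01 : R -> R) setT (@snd (d.-tuple R) R)).
    exact: measurable_indic.
  exact: measurable_snd.
have f_ge0 p : 0 <= f p by rewrite mule_ge0 // ?g_ge0 // lee_fin.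
have := measurable_fun_fubini_tonelli_F (m2 := mu) f mf f_ge0.
rewrite /measurable_rV; apply: eq_measurable_fun => t _ /=; rewrite /fubini_F [RHS]integral_mkcond.
by apply: eq_integral => u _; rewrite epatch_indic /f /= set_coord_rv_of_tuple.
Qed.

Lemma iint_rec_ge0 s g x : (forall y, 0 <= g y) -> 0 <= iint_rec s g x.
Proof. by move=> g_ge0; elim: s x => //= i s IH x; apply: integral_ge0. Qed.

Lemma measurable_rV_iint_rec s g : measurable_rV g -> (forall y, 0 <= g y) ->
  measurable_rV (iint_rec s g).
Proof.
move=> mg g_ge0; elim: s => //= i s IH; apply: measurable_rV_integral => // y.
exact: iint_rec_ge0.
Qed.

Lemma iint_rec_affine s (a b : R) g x : measurable_rV g -> (forall y, 0 <= g y) ->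
  (0 <= a)%R -> (0 <= b)%R ->
  iint_rec s (fun y => a%:E + b%:E * g y) x = a%:E + b%:E * iint_rec s g x.
Proof.
move=> mg g_ge0 a_ge0 b_ge0; elim: s x => //= i s IH x.
transitivity (\int[mu]_(u in I01) (a%:E + b%:E * iint_rec s g (set_coord x i u))).
  by apply: eq_integral => u _; exact: IH.
have m_slice : measurable_fun I01 (fun u => iint_rec s g (set_coord x i u)).
  apply: measurable_funS (measurableT) _ _ => //.
  by apply: measurable_slice; apply: measurable_rV_iint_rec.
rewrite ge0_integralD //; first last.
- by apply: emeasurable_funM => //; exact: measurable_cst.
- by move=> u _; rewrite mule_ge0 // iint_rec_ge0.
rewrite integral_cst // ge0_integralZl //; last by move=> u _; exact: iint_rec_ge0.
congr (_ + _); rewrite -[RHS]mule1; congr (_ * _); exact: unit_interval_measure.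
Qed.

Lemma abse_cube_integralM_le (g phi : 'rV[R]_d -> R) (M : R) :
  measurable_fun [set: d.-tuple R] (g \o @rv_of_tuple R d) ->
  cube_integral (fun x => (g x ^+ 2)%:E) <= 1 ->
  (forall y, cube y -> `|phi y|%R <= M)%R ->
  `|cube_integral (fun x => (g x * phi x)%:E)| <= M%:E.
Proof.
move=> mg g2_le1 phiM.
have M_ge0 : (0 <= M)%R := le_trans (normr_ge0 _) (phiM _ (@cube0 R d)).
have M2_ge0 : (0 <= M / 2)%R by rewrite divr_ge0.
have mg2 : measurable_rV (fun y => (g y ^+ 2)%:E).
  by have := measurable_funX 2 mg; move/measurable_EFinP.
have g2_ge0 y : 0 <= (g y ^+ 2)%:E by rewrite lee_fin sqr_ge0.
(* AM-GM: [`|g * phi| <= M / 2 + M / 2 * g ^+ 2]. *)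
have am_gm y : cube y -> `|(g y * phi y)%:E| <= (M / 2)%:E + (M / 2)%:E * (g y ^+ 2)%:E.
  move=> cy; rewrite -EFinM -EFinD /= lee_fin normrM -[(g y ^+ 2)%R]real_normK ?num_real //.
  apply: le_trans (ler_wpM2l (normr_ge0 (g y)) (phiM y cy)) _.
  by have := mulr_ge0 M_ge0 (sqr_ge0 (`|g y| - 1)%R); lra.
apply: le_trans (abse_iint_rec_le _ am_gm (@cube0 R d)) _; rewrite iint_rec_affine //.
apply: (@le_trans _ _ ((M / 2)%:E + (M / 2)%:E * 1)).
  by rewrite leeD2l // lee_wpmul2l // lee_fin.
by rewrite mule1 -EFinD lee_fin; lra.
Qed.

End IteratedIntegral.

(** * Kernels *)

Section Kernels.
Variable R : realType.
Implicit Types (x y z c e u : R) (b : bool).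

Definition ramp z : R := z * step ((z - 3^-1) / 3^-1).

Lemma smooth_ramp : smooth ramp.
Proof. exact: smoothM (@smooth_id R) (smooth_rescale _ _ (smooth_step R)). Qed.

Lemma ramp_eq0 z : z < 3^-1 -> ramp z = 0.
Proof. by move=> z_lt; rewrite /ramp step_rescale0 ?mulr0 //; lra. Qed.

Lemma ramp_eq_id z : 2 / 3 < z -> ramp z = z.
Proof. by move=> z_gt; rewrite /ramp step_rescale1 ?mulr1 //; lra. Qed.

Lemma derive1_ramp_eq0 z : z < 3^-1 -> ramp^`() z = 0.
Proof. by move=> /(derive1_eq_lt ramp_eq0) ->; rewrite derive1_cst_fun. Qed.

Lemma derive1_ramp_eq1 z : 2 / 3 < z -> ramp^`() z = 1.
Proof. by move=> /(derive1_eq_gt ramp_eq_id) ->; rewrite derive1_id_fun. Qed.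

Lemma derive2_ramp_eq0 z : z <= 0 \/ 1 <= z -> ramp^`(2) z = 0.
Proof.
rewrite derive1nS derive1n1 => -[z_le0|z_ge1].
  by rewrite (derive1_eq_lt derive1_ramp_eq0) ?derive1_cst_fun //; lra.
by rewrite (derive1_eq_gt derive1_ramp_eq1) ?derive1_cst_fun //; lra.
Qed.

Lemma ramp_dist z : `|ramp z - Num.max z 0| <= 1.
Proof.
have [z_le0|z_gt0] := leP z 0; first by rewrite ramp_eq0 ?subrr ?normr0 //; lra.
have [z_ge1|z_lt1] := leP 1 z; first by rewrite ramp_eq_id ?subrr ?normr0 //; lra.
have /andP[step_ge0 step_le1] := step_itv ((z - 3^-1) / 3^-1).
rewrite /ramp ler_norml; apply/andP; split.
  by have := mulr_ge0 (ltW z_gt0) step_ge0; lra.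
by have := ler_wpM2l (ltW z_gt0) step_le1; lra.
Qed.

(* Equal to the positive part of [y - c] outside [c, c + e]. *)
Definition soft_ramp e c y : R := e * ramp ((y - c) / e).

Lemma smooth_soft_ramp e c : smooth (soft_ramp e c).
Proof. by apply/smoothZ/smooth_rescale/smooth_ramp. Qed.

Lemma derive1_soft_ramp e c : e != 0 -> (soft_ramp e c)^`() = fun y => ramp^`() ((y - c) / e).
Proof.
move=> e_neq0; have smooth_r := smooth_rescale c e smooth_ramp.
rewrite (derive1_smoothM (smooth_cst e) smooth_r) derive1_cst_fun (derive1_rescale _ _ smooth_ramp).
by apply/funext => y; rewrite mulr0 addr0 mulrA divff // mul1r.
Qed.

Lemma derive2_soft_ramp e c : e != 0 ->
  (soft_ramp e c)^`(2) = fun y => e^-1 * ramp^`(2) ((y - c) / e).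
Proof.
move=> e_neq0; rewrite !derive1nS !derive1n0 derive1_soft_ramp //.
exact/derive1_rescale/smooth_derive1/smooth_ramp.
Qed.

Lemma soft_ramp_dist e c y : 0 < e -> `|soft_ramp e c y - Num.max (y - c) 0| <= e.
Proof.
move=> e_gt0; have -> : Num.max (y - c) 0 = e * Num.max ((y - c) / e) 0.
  by rewrite maxr_pMr ?(ltW e_gt0) // mulr0 mulrCA divff ?mulr1 // gt_eqF.
rewrite /soft_ramp -mulrBr normrM ger0_norm ?(ltW e_gt0) // -[leRHS]mulr1.
by rewrite ler_wpM2l ?(ltW e_gt0) ?ramp_dist.
Qed.

(* Maps [0, 1] into [e, 1 - 2 e], so that the interval of length [e] to the right of the
   image stays away from the boundary. *)
Definition inward e x : R := e + (1 - 3 * e) * x.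

Lemma inward_itv e x : 0 < e <= 4^-1 -> 0 <= x <= 1 -> e <= inward e x <= 1 - 2 * e.
Proof. by move=> /andP[e_gt0 e_le] /andP[x_ge0 x_le1]; rewrite /inward; apply/andP; split; nra. Qed.

Lemma inward_dist e x : 0 <= e -> 0 <= x <= 1 -> `|inward e x - x| <= 2 * e.
Proof. by move=> e_ge0 /andP[x_ge0 x_le1]; rewrite /inward ler_norml; apply/andP; split; nra. Qed.

Definition mollifier e x : R -> R := (soft_ramp e (inward e x))^`(2).

Lemma smooth_mollifier e x : smooth (mollifier e x).
Proof. exact/smooth_derive1n/smooth_soft_ramp. Qed.

Lemma mollifier_eq0 e x u : 0 < e -> ~~ (inward e x <= u <= inward e x + e) ->
  mollifier e x u = 0.
Proof.
move=> e_gt0; rewrite negb_and -!ltNge => u_out.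
rewrite /mollifier derive2_soft_ramp ?gt_eqF // derive2_ramp_eq0 ?mulr0 //.
by case/orP: u_out => /ltW; [left; rewrite rescale_le0|right; rewrite rescale_ge1].
Qed.

Lemma mollifier_support e x u : 0 < e -> 0 <= x <= 1 -> mollifier e x u != 0 ->
  `|u - x| <= 3 * e.
Proof.
move=> e_gt0 x01; apply: contraNT => u_far; apply/eqP/mollifier_eq0 => //.
apply: contraNN u_far => u_near.
by have := inward_dist (ltW e_gt0) x01; rewrite !ler_norml; lra.
Qed.

Lemma int01_mollifier e x : 0 < e <= 4^-1 -> 0 <= x <= 1 -> int01 (mollifier e x) = 1.
Proof.
move=> e_itv x01; have /andP[e_gt0 _] := e_itv; have c01 := inward_itv e_itv x01.
rewrite /mollifier derive1nS derive1n1 int01_derive1; last exact/smooth_derive1/smooth_soft_ramp.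
rewrite derive1_soft_ramp ?gt_eqF // derive1_ramp_eq1 ?derive1_ramp_eq0 ?subr0 //.
  by apply: le_lt_trans (_ : _ <= 0) _; rewrite ?rescale_le0 //; lra.
by apply: lt_le_trans (_ : 1 <= _); rewrite ?rescale_ge1 //; lra.
Qed.

Definition cutoff y : R := step ((y - 4^-1) / 2^-1).

Lemma cutoff_itv y : 0 <= cutoff y <= 1.
Proof. exact: step_itv. Qed.

Lemma smooth_cutoff : smooth cutoff.
Proof. exact/smooth_rescale/smooth_step. Qed.

Definition cutoff_line c y : R := (y - c) * cutoff y.

Lemma smooth_cutoff_line c : smooth (cutoff_line c).
Proof. exact: smoothM (smoothB (@smooth_id R) (smooth_cst c)) smooth_cutoff. Qed.

Lemma cutoff_line_eq0 c y : y < 4^-1 -> cutoff_line c y = 0.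
Proof. by move=> y_lt; rewrite /cutoff_line /cutoff step_rescale0 ?mulr0 //; lra. Qed.

Lemma cutoff_line_eq_line c y : 3 / 4 < y -> cutoff_line c y = y - c.
Proof. by move=> y_gt; rewrite /cutoff_line /cutoff step_rescale1 ?mulr1 //; lra. Qed.

Lemma derive2_cutoff_line c :
  (cutoff_line c)^`(2) = fun y => 2 * cutoff^`() y + (y - c) * cutoff^`(2) y.
Proof.
have sl := smoothB (@smooth_id R) (smooth_cst c).
have smooth_cutoff' := smooth_derive1 smooth_cutoff.
rewrite !derive1nS !derive1n0 (derive1_smoothM sl smooth_cutoff) derive1_subc.
have smooth_cutoff_cst := smoothM smooth_cutoff (smooth_cst (1 : R)).
rewrite derive1_smoothD ?(derive1_smoothM sl smooth_cutoff') ?derive1_subc //; last exact: smoothM.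
rewrite (derive1_smoothM smooth_cutoff (smooth_cst _)) derive1_cst_fun.
by apply/funext => y; ring.
Qed.

Lemma derive2_cutoff_line_eq0 c y : y < 4^-1 \/ 3 / 4 < y -> (cutoff_line c)^`(2) y = 0.
Proof.
rewrite derive1nS derive1n1 => -[y_lt|y_gt].
  have derive1_line z : z < 4^-1 -> (cutoff_line c)^`() z = 0.
    by move=> /(derive1_eq_lt (@cutoff_line_eq0 c)) ->; rewrite derive1_cst_fun.
  by rewrite (derive1_eq_lt derive1_line y_lt) derive1_cst_fun.
have derive1_line z : 3 / 4 < z -> (cutoff_line c)^`() z = 1.
  by move=> /(derive1_eq_gt (@cutoff_line_eq_line c)) ->; rewrite derive1_subc.
by rewrite (derive1_eq_gt derive1_line y_gt) derive1_cst_fun.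
Qed.

(* [ker true x] is a parametrix: its second derivative in [y] is the point mass at [x]
   minus the smooth remainder [ker false x]. *)
Definition ker b x y : R :=
  if b then Num.max (y - x) 0 - cutoff_line x y else (cutoff_line x)^`(2) y.

Definition soft_ker b e x y : R :=
  if b then soft_ramp e (inward e x) y - cutoff_line (inward e x) y
  else (cutoff_line (inward e x))^`(2) y.

Lemma smooth_soft_ker b e x : smooth (soft_ker b e x).
Proof.
case: b; last exact: (smooth_derive1n 2) (smooth_cutoff_line _).
exact: smoothB (smooth_soft_ramp _ _) (smooth_cutoff_line _).
Qed.

Lemma soft_ker_eq0 b e x y : 0 < e <= 4^-1 -> 0 <= x <= 1 -> y < e \/ 1 - e < y ->
  soft_ker b e x y = 0.
Proof.
move=> e_itv x01 y_out; have c01 := inward_itv e_itv x01; have /andP[e_gt0 e_le4] := e_itv.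
case: b; last by apply: derive2_cutoff_line_eq0; case: y_out; [left|right]; lra.
rewrite /soft_ker /soft_ramp; case: y_out => y_out.
  rewrite cutoff_line_eq0 ?ramp_eq0 ?mulr0 ?subrr //; last lra.
  by apply: le_lt_trans (_ : _ <= 0) _; rewrite ?rescale_le0 //; lra.
rewrite cutoff_line_eq_line ?ramp_eq_id; [by field; rewrite gt_eqF| |lra].
by apply: lt_le_trans (_ : 1 <= _); rewrite ?rescale_ge1 //; lra.
Qed.

Lemma soft_ker_mollifier e x y :
  (soft_ker true e x)^`(2) y + soft_ker false e x y = mollifier e x y.
Proof.
have sr := smooth_soft_ramp e (inward e x); have sl := smooth_cutoff_line (inward e x).
rewrite /mollifier !derive1nS !derive1n0 /soft_ker derive1_smoothB // derive1_smoothB ?subrK //;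
  exact: smooth_derive1.
Qed.

Definition kernel_bound A : Prop := forall y, 0 <= y <= 1 ->
  [/\ `|cutoff^`() y| <= A, `|cutoff^`(2) y| <= A & `|ramp^`(2) y| <= A].

Lemma exists_kernel_bound : exists2 A : R, 1 <= A & kernel_bound A.
Proof.
have [A cutoff1_le] := smooth_bounded (smooth_derive1 smooth_cutoff).
have [B cutoff2_le] := smooth_bounded (smooth_derive1n 2 smooth_cutoff).
have [D ramp2_le] := smooth_bounded (smooth_derive1n 2 smooth_ramp).
exists (Num.max 1 (Num.max A (Num.max B D))) => [|y y01]; first by rewrite le_max lexx.
split; rewrite !le_max.
- by rewrite cutoff1_le ?orbT.
- by rewrite cutoff2_le ?orbT.
- by rewrite ramp2_le ?orbT.
Qed.

Lemma tent_absdist u : tent u = 2 * absdist 2^-1 u.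
Proof.
rewrite /tent /absdist -[X in X * `|_|]ger0_norm // -normrM.
by congr `|_|; field.
Qed.

Lemma max_sub_tent y u : 0 <= y ->
  Num.max (y - tent u) 0 = absdist ((1 + y) / 2) u + absdist ((1 - y) / 2) u - tent u.
Proof.
move=> y_ge0; rewrite /tent /absdist.
have [v_ge0|v_lt0] := ger0P (2 * u - 1); case: leP => yv; case: ger0P => ?; case: ger0P => ?; lra.
Qed.

Section KernelBounds.
Variable A : R.
Hypotheses (A_ge1 : 1 <= A) (bound_A : kernel_bound A).

Lemma int01_norm_mollifier_le e x : 0 < e <= 4^-1 -> 0 <= x <= 1 ->
  int01 (fun u => `|mollifier e x u|) <= A.
Proof.
move=> e_itv x01; have /andP[e_gt0 e_le4] := e_itv; have c01 := inward_itv e_itv x01.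
have -> : A = A / e * (inward e x + e - inward e x) by field; rewrite gt_eqF.
apply: int01_supported_le; try lra.
- by apply/cont01_norm/continuous_subspaceT/smooth_continuous/smooth_mollifier.
- by move=> u _ u_out; rewrite mollifier_eq0 ?normr0.
move=> u u_in; rewrite /mollifier derive2_soft_ramp ?gt_eqF // normrM mulrC.
rewrite [`|e^-1|]ger0_norm ?invr_ge0 ?(ltW e_gt0) // ler_wpM2r ?invr_ge0 ?(ltW e_gt0) //.
have /bound_A[] // : 0 <= (u - inward e x) / e <= 1.
by rewrite ler_pdivrMr // divr_ge0 ?(ltW e_gt0) //; lra.
Qed.

Lemma ker_norm_le b x y : 0 <= x <= 1 -> 0 <= y <= 1 -> `|ker b x y| <= 3 * A.
Proof.
move=> x01 y01; have yx_le1 : `|y - x| <= 1 by rewrite ler_norml; lra.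
rewrite /ker; case: b.
  have max_le : `|Num.max (y - x) 0| <= 1.
    by rewrite ger0_norm ?le_max ?lexx ?orbT // ge_max; lra.
  have line_le : `|cutoff_line x y| <= 1.
    rewrite normrM mulr_ile1 //.
    by have := cutoff_itv y; rewrite ler_norml; lra.
  by have := ler_normB (Num.max (y - x) 0) (cutoff_line x y); move: A_ge1; lra.
have [cutoff1_y cutoff2_y _] := bound_A y01.
have line_le : `|(y - x) * cutoff^`(2) y| <= A by rewrite normrM -[A]mul1r ler_pM.
rewrite derive2_cutoff_line; apply: le_trans (ler_normD _ _) _.
by rewrite normrM [`|2|]ger0_norm //; lra.
Qed.

Lemma ker_lipschitz b x x' y : 0 <= y <= 1 -> `|ker b x y - ker b x' y| <= 2 * A * `|x - x'|.
Proof.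
move=> y01; have [_ cutoff2_y _] := bound_A y01.
have xx_le : `|x - x'| <= A * `|x - x'| by rewrite ler_peMl.
rewrite -mulrA /ker; case: b.
  have -> : Num.max (y - x) 0 - cutoff_line x y - (Num.max (y - x') 0 - cutoff_line x' y)
      = (Num.max (y - x) 0 - Num.max (y - x') 0) + (x - x') * cutoff y.
    by rewrite /cutoff_line; ring.
  apply: le_trans (ler_normD _ _) _; rewrite normrM.
  have max_le : `|Num.max (y - x) 0 - Num.max (y - x') 0| <= `|x - x'|.
    rewrite [leRHS]distrC; have := ler_norm (x - x'); have := ler_norm (x' - x).
    rewrite distrC ler_norml.
    by case: (leP (y - x) 0); case: (leP (y - x') 0); lra.
  have cutoff_le : `|x - x'| * `|cutoff y| <= `|x - x'|.
    by rewrite ler_piMr //; have := cutoff_itv y; rewrite ler_norml; lra.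
  by lra.
rewrite !derive2_cutoff_line.
have -> : 2 * cutoff^`() y + (y - x) * cutoff^`(2) y - (2 * cutoff^`() y + (y - x') * cutoff^`(2) y)
    = - (cutoff^`(2) y * (x - x')) by ring.
have := ler_wpM2r (normr_ge0 (x - x')) cutoff2_y.
by rewrite normrN normrM; have := normr_ge0 (x - x'); lra.
Qed.

Lemma soft_ker_dist b e x y : 0 < e <= 4^-1 -> 0 <= x <= 1 -> 0 <= y <= 1 ->
  `|soft_ker b e x y - ker b x y| <= 5 * A * e.
Proof.
move=> e_itv x01 y01; have /andP[e_gt0 _] := e_itv.
have soft_dist : `|soft_ker b e x y - ker b (inward e x) y| <= e.
  rewrite /soft_ker /ker; case: b; last by rewrite subrr normr0 ltW.
  by rewrite opprB addrA subrK soft_ramp_dist.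
have shift_dist : `|ker b (inward e x) y - ker b x y| <= 2 * A * (2 * e).
  apply: le_trans (ker_lipschitz b _ _ y01) _.
  by rewrite ler_wpM2l ?inward_dist ?(ltW e_gt0) // mulr_ge0 // (le_trans ler01).
have e_le : e <= A * e by rewrite ler_peMl ?(ltW e_gt0).
apply: le_trans (ler_distD (ker b (inward e x) y) _ _) _.
apply: le_trans (lerD soft_dist shift_dist) _.
rewrite (_ : 5 * A * e = A * e + 2 * A * (2 * e)); last by ring.
by rewrite lerD2r.
Qed.

Lemma soft_ker_norm_le b e x y : 0 < e <= 4^-1 -> 0 <= x <= 1 -> 0 <= y <= 1 ->
  `|soft_ker b e x y| <= 5 * A.
Proof.
move=> e_itv x01 y01; have /andP[e_gt0 e_le4] := e_itv.
rewrite -[soft_ker b e x y](subrK (ker b x y)); apply: le_trans (ler_normD _ _) _.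
apply: le_trans (lerD (soft_ker_dist b e_itv x01 y01) (ker_norm_le b x01 y01)) _.
by have := ler_wpM2l (le_trans ler01 A_ge1) e_le4; move: A_ge1; lra.
Qed.

Lemma polygonal_ker_tent b y : 0 <= y <= 1 -> polygonal (5 * A) (fun u => ker b (tent u) y).
Proof.
move=> y01; have [cutoff1_y cutoff2_y _] := bound_A y01.
case: b.
  have /andP[cutoff_ge0 cutoff_le1] := cutoff_itv y; have /andP[y_ge0 y_le1] := y01.
  exists (- (y * cutoff y)),
    [:: (2 * (cutoff y - 1), 2^-1); (1, (1 + y) / 2); (1, (1 - y) / 2)].
  split=> [||u].
  - have y_cutoff : `|y * cutoff y| <= 1 by rewrite ger0_norm; [exact: mulr_ile1|exact: mulr_ge0].
    have cutoff_le : `|2 * (cutoff y - 1)| <= 2 by rewrite ler_norml; lra.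
    rewrite !big_cons big_nil /= normrN normr1; move: y_cutoff cutoff_le A_ge1.
    by move: `|y * cutoff y| `|2 * _| => p q; lra.
  - by rewrite /= andbT; apply/and3P; split; lra.
  by rewrite !big_cons big_nil /= /cutoff_line max_sub_tent // tent_absdist; ring.
have kerE u : ker false (tent u) y = 2 * cutoff^`() y + (y - tent u) * cutoff^`(2) y.
  by rewrite /ker derive2_cutoff_line.
move: (cutoff^`() y) (cutoff^`(2) y) kerE cutoff1_y cutoff2_y => p q kerE p_le q_le.
exists (2 * p + y * q), [:: (- 2 * q, 2^-1)].
split=> [||u].
- have yq_le : `|y * q| <= A by rewrite normrM -[A]mul1r ler_pM // ler_norml; lra.
  rewrite big_seq1 /= normrM normrN [`|2|]ger0_norm //.
  by have := ler_normD (2 * p) (y * q); rewrite [`|2 * p|]normrM [`|2|]ger0_norm //; lra.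
- by rewrite /= andbT; lra.
by rewrite big_seq1 kerE tent_absdist /=; ring.
Qed.

End KernelBounds.
End Kernels.

(** * Point functionals on the unit ball *)

Section PolygonalProducts.
Variables (R : realType) (d : nat) (A : R) (h : 'I_d -> R -> R).
Hypothesis polygonal_h : forall i, polygonal A (h i).

Lemma polygonal_prod_dmean_dist m :
  `|\prod_i dmean m (h i) - \prod_i int01 (h i)| <= d%:R * A ^+ d * 2^-1 ^+ m.
Proof.
have cont_h i : {within `[0%R : R, 1%R], continuous (h i)}%classic.
  exact/lipschitz01_cont01/polygonal_lipschitz/polygonal_h.
apply: prod_dist => [|i|i|i]; first exact: half_exp_ge0.
- by have := walsh_polygonal_le (0 : 'rV_m) (polygonal_h i); rewrite walsh0 row_wt0 mulr1.
- by apply: int01_le_cst => // u; apply: polygonal_le.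
apply: dmean_int01_dist => // u v u01 v01 uv_le.
apply: le_trans (polygonal_lipschitz (polygonal_h i) u01 v01) _; rewrite ler_wpM2l //.
exact: le_trans (normr_ge0 _) (polygonal_le (polygonal_h i) u01).
Qed.

Lemma net_mean_int01_dist t n (C : 'I_d -> 'M['F_2]_(2 * n, n)) :
  (0 < d)%N -> order2_digital_net t C ->
  `|net_mean C (fun x => \prod_i h i (x i)) - \prod_i int01 (h i)|
    <= (d + 4)%:R * A ^+ d * (2 ^+ t * 2^-1 ^+ (2 * n) * (2 * n).+1%:R ^+ (2 * d - 1)).
Proof.
move=> d_gt0 netC.
have net_dist := net_mean_dist C (fun i r => walsh_polygonal_le r (polygonal_h i)).
have mean_dist := polygonal_prod_dmean_dist (2 * n).
have dual_le := dual_sum_le netC d_gt0 R; have sub_le := half_exp_subn_le R (2 * n) t.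
have Ad_ge0 : 0 <= A ^+ d.
  rewrite exprn_ge0 // (le_trans (normr_ge0 (h (Ordinal d_gt0) 0))) //.
  by apply: polygonal_le => //; rewrite lexx ler01.
set c := (2 * n).+1%:R ^+ (2 * d - 1) in dual_le *; set e := 2^-1 ^+ (2 * n) in mean_dist sub_le *.
have c_ge1 : 1 <= c by rewrite exprn_ege1 // ler1n.
have e_le : e <= 2 ^+ t * e * c.
  rewrite mulrAC ler_peMl ?half_exp_ge0 // -[leLHS]mul1r ler_pM //.
  by rewrite exprn_ege1 ?ler1n.
apply: le_trans (ler_distD (\prod_i dmean (2 * n) (h i)) _ _) _.
apply: le_trans (lerD net_dist mean_dist) _.
have -> : (d + 4)%:R * A ^+ d * (2 ^+ t * e * c)
    = A ^+ d * (4 * (2 ^+ t * e * c)) + d%:R * A ^+ d * (2 ^+ t * e * c) by rewrite natrD; ring.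
apply: lerD; last by rewrite ler_wpM2l ?mulr_ge0.
rewrite ler_wpM2l //; apply: le_trans dual_le _; rewrite -mulrA ler_wpM2l // mulrC.
by rewrite ler_wpM2r // (le_trans ler01).
Qed.

End PolygonalProducts.

Section PointFunctional.
Variables (R : realType) (d : nat) (I : finType) (a : I -> R) (x : I -> 'rV[R]_d).
Local Notation cube := (@unit_cube R d).
Hypothesis cube_x : forall q, cube (x q).
Implicit Types (E : {set 'I_d}) (f : 'rV[R]_d -> R).

Definition ker_functional E := tensor_sum a (fun q i => ker (i \in E) (x q ord0 i)).

Definition soft_functional e E := tensor_sum a (fun q i => soft_ker (i \in E) e (x q ord0 i)).

Definition mollified_functional e := tensor_sum a (fun q i => mollifier e (x q ord0 i)).

Lemma sum_mixed2_soft_functional e y :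
  \sum_E mixed2 E (soft_functional e E) y = mollified_functional e y.
Proof.
transitivity (\sum_(E : {set 'I_d}) tensor_sum a (fun q i => if i \in E
    then (soft_ker (i \in E) e (x q ord0 i))^`(2) else soft_ker (i \in E) e (x q ord0 i)) y).
  apply: eq_bigr => E _; rewrite mixed2_tensor_sum // => q i; exact: smooth_soft_ker.
rewrite exchange_big; apply: eq_bigr => q _; rewrite -mulr_sumr; congr (_ * _).
rewrite (eq_bigr _ (fun i _ => esym (soft_ker_mollifier e (x q ord0 i) (y ord0 i)))) bigA_distr.
by apply: eq_bigr => E _; apply: eq_bigr => i _; case: (i \in E).
Qed.

Lemma mollified_functional_le f e B : H2mix_unit_ball f -> 0 < e <= 4^-1 ->
  (forall E y, cube y -> `|soft_functional e E y| <= B) ->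
  `|riint (enum 'I_d) (fun y => f y * mollified_functional e y) 0| <= 2 ^+ d * B.
Proof.
move=> [cf [g [mg [weak norm_le1]]]] e_itv soft_le; have cube_0 := @cube0 R d.
have e_gt0 : 0 < e by case/andP: e_itv.
have smooth_sk E q i : smooth (soft_ker (i \in E) e (x q ord0 i)) by exact: smooth_soft_ker.
have ucont_mixed E : ucont (fun y => f y * mixed2 E (soft_functional e E) y).
  apply: within_continuous_ucont => y; apply: continuousM; first exact: cf.
  rewrite mixed2_tensor_sum; last exact: smooth_sk.
  apply: continuous_subspaceT; apply: continuous_tensor_sum => q i; apply: smooth_continuous.
  by case: ifP => _; [apply: smooth_derive1n|]; exact: smooth_sk.
have -> : riint (enum 'I_d) (fun y => f y * mollified_functional e y) 0
    = \sum_E riint (enum 'I_d) (fun y => f y * mixed2 E (soft_functional e E) y) 0.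
  rewrite -riint_sum //; apply: eq_riint => // y _.
  by rewrite -mulr_sumr sum_mixed2_soft_functional.
apply: le_trans (ler_norm_sum _ _ _) _.
have -> : 2 ^+ d * B = \sum_(E : {set 'I_d}) B.
  by rewrite sumr_const -cardsT -powersetT card_powerset cardsT card_ord -[RHS]mulr_natl natrX.
apply: ler_sum => E _; rewrite -lee_fin -abse_EFin -EFin_riint //.
have test_soft : test_function (soft_functional e E).
  apply: (@test_function_tensor_sum _ _ _ _ _ e) => // q i u.
  exact/soft_ker_eq0/cube_x.
rewrite -[X in `|X|%E]/(cube_integral _) (weak E _ test_soft).
apply: abse_cube_integralM_le => //; last exact: soft_le.
apply: le_trans norm_le1; rewrite (bigD1 E) //= leeDl // sume_ge0 // => F _.
by apply: iint_rec_ge0 => y; rewrite lee_fin sqr_ge0.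
Qed.

Section KernelBounds.
Variable A : R.
Hypotheses (A_ge1 : 1 <= A) (bound_A : kernel_bound A).

Lemma soft_functional_dist e E y : 0 < e <= 4^-1 -> cube y ->
  `|soft_functional e E y - ker_functional E y| <= (\sum_q `|a q|) * (d%:R * (5 * A) ^+ d * e).
Proof.
move=> e_itv cy; have e_ge0 : 0 <= e by case/andP: e_itv => /ltW.
rewrite /soft_functional /ker_functional /tensor_sum -sumrB mulr_suml.
apply: le_trans (ler_norm_sum _ _ _) _; apply: ler_sum => q _.
rewrite -mulrBr normrM ler_wpM2l //; apply: prod_dist => // i.
- exact: (soft_ker_norm_le A_ge1 bound_A _ e_itv (cube_x q i) (cy i)).
- apply: le_trans (ker_norm_le A_ge1 bound_A _ (cube_x q i) (cy i)) _.
  by rewrite ler_wpM2r ?ler_nat // (le_trans ler01).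
- exact: (soft_ker_dist A_ge1 bound_A _ e_itv (cube_x q i) (cy i)).
Qed.

Lemma mollified_functional_dist f e omega : {within cube, continuous f} ->
  0 < e <= 4^-1 -> 0 <= omega -> modulus f (3 * e) omega ->
  `|riint (enum 'I_d) (fun y => f y * mollified_functional e y) 0 - \sum_q a q * f (x q)|
    <= (\sum_q `|a q|) * (omega * A ^+ d).
Proof.
move=> cf e_itv omega_ge0 mf; have cube_0 := @cube0 R d; have e_gt0 : 0 < e by case/andP: e_itv.
have cm q i : continuous (mollifier e (x q ord0 i)) by exact/smooth_continuous/smooth_mollifier.
pose F q y := f y * \prod_i mollifier e (x q ord0 i) (y ord0 i).
have uF q : ucont (F q).
  apply: within_continuous_ucont => y; apply: continuousM; first exact: cf.
  exact: (continuous_subspaceT (continuous_coord_prod (cm q))).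
have -> : riint (enum 'I_d) (fun y => f y * mollified_functional e y) 0
    = \sum_q a q * riint (enum 'I_d) (F q) 0.
  under [RHS]eq_bigr => q _ do rewrite -riintZ //.
  rewrite -riint_sum //; last by move=> q; exact: ucontZ.
  apply: eq_riint => // y _; rewrite /mollified_functional /tensor_sum mulr_sumr.
  by apply: eq_bigr => q _; rewrite mulrCA.
rewrite -sumrB mulr_suml; apply: le_trans (ler_norm_sum _ _ _) _; apply: ler_sum => q _.
rewrite -mulrBr normrM ler_wpM2l //.
apply: (riint_mollify_dist (w := fun i => mollifier e (x q ord0 i))
  cf (cube_x q) omega_ge0 mf) => i.
- exact: cm.
- exact: int01_mollifier e_itv (cube_x q i).
- exact: (int01_norm_mollifier_le bound_A e_itv (cube_x q i)).
- by move=> u _; exact: mollifier_support e_gt0 (cube_x q i).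
Qed.

End KernelBounds.

Lemma point_functional_le f B : H2mix_unit_ball f ->
  (forall E y, cube y -> `|ker_functional E y| <= B) -> `|\sum_q a q * f (x q)| <= 2 ^+ d * B.
Proof.
move=> ball_f ker_le; have [cf _] := ball_f.
have [A A_ge1 bound_A] := exists_kernel_bound R.
have A_ge0 : 0 <= A := le_trans ler01 A_ge1.
pose sa := \sum_q `|a q|; have sa_ge0 : 0 <= sa by apply: sumr_ge0.
pose c := d%:R * (5 * A) ^+ d; have c_ge0 : 0 <= c by rewrite mulr_ge0 // exprn_ge0 // mulr_ge0.
apply: (@ler_addgt0M _ (2 ^+ d * (sa * c) + sa * A ^+ d)) => [|omega omega_gt0].
  by apply: addr_ge0; rewrite mulr_ge0 ?exprn_ge0 // mulr_ge0.
have [delta delta_gt0 mf] := within_continuous_ucont cf omega_gt0.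
pose e := Num.min 4^-1 (Num.min (delta / 3) omega).
have e_gt0 : 0 < e by rewrite !lt_min invr_gt0 ltr0n /= omega_gt0 divr_gt0.
have e_itv : 0 < e <= 4^-1 by rewrite e_gt0 ge_min lexx.
have e_delta : 3 * e <= delta by rewrite mulrC -ler_pdivlMr // !ge_min lexx orbT.
have e_omega : e <= omega by rewrite !ge_min lexx !orbT.
have mf_3e : modulus f (3 * e) omega.
  by move=> y z cy cz yz; apply: mf => // i; apply: le_trans e_delta.
have soft_le E y : cube y -> `|soft_functional e E y| <= B + sa * (c * e).
  move=> cy; rewrite -[soft_functional e E y](subrK (ker_functional E y)) addrC.
  apply: le_trans (ler_normD _ _) _; apply: lerD; first exact: ker_le.
  exact: soft_functional_dist.
rewrite -[\sum_q _](subKr (riint (enum 'I_d) (fun y => f y * mollified_functional e y) 0)).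
apply: le_trans (ler_normB _ _) _.
have mollified_le := mollified_functional_le ball_f e_itv soft_le.
have mollified_dist := mollified_functional_dist bound_A cf e_itv (ltW omega_gt0) mf_3e.
apply: le_trans (lerD mollified_le mollified_dist) _.
have -> : 2 ^+ d * B + (2 ^+ d * (sa * c) + sa * A ^+ d) * omega
    = 2 ^+ d * (B + sa * (c * omega)) + sa * (omega * A ^+ d) by ring.
by rewrite lerD2r ler_wpM2l ?exprn_ge0 // lerD2l !ler_wpM2l.
Qed.

End PointFunctional.

Lemma cont01_ker (R : realType) (A : R) b y : 1 <= A -> kernel_bound A -> 0 <= y <= 1 ->
  {within `[0%R : R, 1%R], continuous (fun u => ker b u y)}.
Proof.
move=> A_ge1 bound_A y01; apply: (@lipschitz01_cont01 _ (2 * A)) => u v _ _.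
exact: (ker_lipschitz A_ge1 bound_A b u v y01).
Qed.

Section Quadrature.
Variables (R : realType) (d : nat).
Local Notation cube := (@unit_cube R d).
Implicit Types (E : {set 'I_d}) (y z : 'rV[R]_d).

Definition ker_prod E y z : R := \prod_i ker (i \in E) (z ord0 i) (y ord0 i).

Definition int_ker_prod E y : R := \prod_i int01 (fun u => ker (i \in E) u (y ord0 i)).

Lemma modulus_ker_prod A E y delta : 1 <= A -> kernel_bound A -> cube y -> 0 <= delta ->
  modulus (ker_prod E y) delta (d%:R * (3 * A) ^+ d * delta).
Proof.
move=> A_ge1 bound_A cy delta_ge0 z z' cz cz' zz'; apply: prod_dist => // i.
- exact: (ker_norm_le A_ge1 bound_A _ (cz i) (cy i)).
- exact: (ker_norm_le A_ge1 bound_A _ (cz' i) (cy i)).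
apply: le_trans (ker_lipschitz A_ge1 bound_A _ _ _ (cy i)) _.
by rewrite ler_pM ?zz' ?mulr_ge0 ?ler_wpM2r ?ler_nat // (le_trans ler01).
Qed.

Lemma dmean_iter_ker_prod_dist A E y m : 1 <= A -> kernel_bound A -> cube y ->
  `|dmean_iter m (enum 'I_d) (ker_prod E y) 0 - int_ker_prod E y|
    <= d%:R * (d%:R * (3 * A) ^+ d * 2^-1 ^+ m).
Proof.
move=> A_ge1 bound_A cy; have mK delta := modulus_ker_prod E A_ge1 bound_A cy (delta := delta).
have A_ge0 : 0 <= A := le_trans ler01 A_ge1.
have uK : ucont (ker_prod E y).
  apply: (@lipschitz_ucont _ _ _ (d%:R * (3 * A) ^+ d)) => //.
  by rewrite mulr_ge0 // exprn_ge0 // mulr_ge0.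
rewrite /int_ker_prod -(riint_coord_prod (fun i => cont01_ker A_ge1 bound_A (cy i))).
rewrite -[X in X%:R * _](size_enum_ord d).
by apply: dmean_iter_dist => //; [apply: mK; exact: half_exp_ge0|exact: cube0].
Qed.

(* The integral is replaced by an equal-weight mean over a fine grid, which turns the
   quadrature error into a combination of point values. *)
Lemma quadrature_error_le (f : 'rV[R]_d -> R) (I : finType) (w : I -> R) (x : I -> 'rV[R]_d) B :
  H2mix_unit_ball f -> (forall q, cube (x q)) ->
  (forall E y, cube y -> `|\sum_q w q * ker_prod E y (x q) - int_ker_prod E y| <= B) ->
  `|\sum_q w q * f (x q) - riint (enum 'I_d) f 0| <= 2 ^+ d * B.
Proof.
move=> ball_f cube_x ker_le; have [cf _] := ball_f; have uf := within_continuous_ucont cf.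
have [A A_ge1 bound_A] := exists_kernel_bound R; have A_ge0 : 0 <= A := le_trans ler01 A_ge1.
pose c := d%:R * (3 * A) ^+ d; have c_ge0 : 0 <= c by rewrite mulr_ge0 // exprn_ge0 // mulr_ge0.
apply: (@ler_addgt0M _ (2 ^+ d * (d%:R * c) + d%:R)) => [|omega omega_gt0].
  by rewrite addr_ge0 // mulr_ge0 ?exprn_ge0 // mulr_ge0.
have [delta delta_gt0 mf] := uf omega omega_gt0.
have [|m] := @exists_half_exp_le R (Num.min delta omega); first by rewrite lt_min delta_gt0.
rewrite le_min => /andP[m_delta m_omega].
pose grid_mean (F : 'rV[R]_d -> R) := dmean_iter m (enum 'I_d) F 0.
have [J [v [z [cube_z gridE]]]] := dmean_iter_points R m (enum 'I_d).
pose a (q : I + J) := match q with inl q => w q | inr q => - v q end.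
pose p (q : I + J) := match q with inl q => x q | inr q => z 0 q end.
have functionalE F : \sum_q a q * F (p q) = \sum_q w q * F (x q) - grid_mean F.
  rewrite big_sumType /= /grid_mean gridE -sumrN; congr (_ + _).
  by apply: eq_bigr => q _; rewrite mulNr.
have cube_p q : cube (p q) by case: q => q //=; apply: cube_z; exact: cube0.
have grid_f : `|grid_mean f - riint (enum 'I_d) f 0| <= d%:R * omega.
  rewrite -[X in X%:R * _](size_enum_ord d); apply: dmean_iter_dist => //; last exact: cube0.
  by move=> y y' cy cy' yy'; apply: mf => // i; apply: le_trans m_delta.
have point_le E y : cube y -> `|ker_functional a p E y| <= B + d%:R * (c * omega).
  move=> cy; rewrite [X in `|X|](functionalE (ker_prod E y)).
  apply: le_trans (ler_distD (int_ker_prod E y) _ _) _; apply: lerD; first exact: ker_le.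
  rewrite distrC; apply: le_trans (dmean_iter_ker_prod_dist E m A_ge1 bound_A cy) _.
  by rewrite !ler_wpM2l.
have := point_functional_le cube_p ball_f point_le; rewrite functionalE => points_f.
apply: le_trans (ler_distD (grid_mean f) _ _) _; apply: le_trans (lerD points_f grid_f) _.
by rewrite mulrDl mulrDr -!mulrA addrA.
Qed.

Lemma tent_net_ker_prod_dist t n (C : 'I_d -> 'M['F_2]_(2 * n, n)) A E y :
  (0 < d)%N -> order2_digital_net t C -> 1 <= A -> kernel_bound A -> cube y ->
  `|\sum_(k < 2 ^ n) (2 ^ n)%:R^-1 * ker_prod E y (tent_net_point R C k) - int_ker_prod E y|
    <= (d + 4)%:R * (5 * A) ^+ d
       * (2 ^+ t * 2^-1 ^+ (2 * n) * (2 * n).+1%:R ^+ (2 * d - 1)).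
Proof.
move=> d_gt0 netC A_ge1 bound_A cy.
pose h (i : 'I_d) u := ker (i \in E) (tent u) (y ord0 i).
have -> : int_ker_prod E y = \prod_i int01 (h i).
  apply: eq_bigr => i _; apply: esym.
  exact: int01_tent (cont01_ker (b := i \in E) A_ge1 bound_A (cy i)).
have -> : \sum_(k < 2 ^ n) (2 ^ n)%:R^-1 * ker_prod E y (tent_net_point R C k)
    = net_mean C (fun x => \prod_i h i (x i)).
  rewrite /net_mean mulr_sumr; apply: eq_bigr => k _.
  suff -> : ker_prod E y (tent_net_point R C k) = \prod_i h i (net_coord R C k i) by [].
  by apply: eq_bigr => i _; rewrite mxE.
by apply: net_mean_int01_dist => // i; exact: polygonal_ker_tent.
Qed.

End Quadrature.

Lemma net_rate_le (R : realType) q n : (0 < n)%N ->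
  2^-1 ^+ (2 * n) * (2 * n).+1%:R ^+ q
    <= (3 / ln 2) ^+ q * (((2 ^ n)%:R ^+ 2)^-1 * ln (2 ^ n)%:R ^+ q) :> R.
Proof.
move=> n_gt0; have ln2_gt0 : 0 < ln 2 :> R by rewrite ln_gt0 // ltr1n.
have -> : ((2 ^ n)%:R ^+ 2)^-1 = 2^-1 ^+ (2 * n) :> R by rewrite natrX -exprM mulnC exprVn.
have -> : ln (2 ^ n)%:R = n%:R * ln 2 :> R by rewrite natrX lnXn // mulr_natl.
rewrite mulrCA ler_wpM2l ?half_exp_ge0 // -exprMn.
have -> : 3 / ln 2 * (n%:R * ln 2) = 3 * n%:R :> R by field; rewrite gt_eqF.
by rewrite lerXn2r ?nnegrE ?mulr_ge0 // -natrM ler_nat; lia.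
Qed.

Theorem theorem5p2 (R : realType) (d : nat) (d_gt0 : (0 < d)%N) :
  exists2 K : R, 0 < K &
    forall (t n : nat) (C : 'I_d -> 'M['F_2]_(2 * n, n)),
      (0 < n)%N ->
      order2_digital_net t C ->
      (eQMC (tent_net_point R C) <=
         (K * 2 ^+ t * ((2 ^ n)%:R ^+ 2)^-1 * ln ((2 ^ n)%:R) ^+ (2 * d - 1))%:E)%E.
Proof.
have [A A_ge1 bound_A] := exists_kernel_bound R; have A_gt0 : 0 < A := lt_le_trans ltr01 A_ge1.
pose c : R := 2 ^+ d * ((d + 4)%:R * (5 * A) ^+ d).
have c_gt0 : 0 < c by rewrite !mulr_gt0 ?exprn_gt0 ?mulr_gt0 // ltr0n addnS.
have ln2_gt0 : 0 < ln 2 :> R by rewrite ln_gt0 // ltr1n.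
exists (c * (3 / ln 2) ^+ (2 * d - 1)) => [|t n C n_gt0 netC].
  by rewrite mulr_gt0 ?exprn_gt0 ?divr_gt0.
apply: ge_ereal_sup => _ [f ball_f <-]; have [cf _] := ball_f.
rewrite /cube_integral (EFin_riint _ (within_continuous_ucont cf) (@cube0 R d)).
rewrite -EFinB abse_EFin lee_fin mulr_sumr.
apply: le_trans (quadrature_error_le ball_f _ _) _ => [k|E y|].
- by move=> i; rewrite mxE; apply/tent_itv/dyadic_itv.
- exact: (tent_net_ker_prod_dist E d_gt0 netC A_ge1 bound_A).
have ct_ge0 : 0 <= c * 2 ^+ t by rewrite mulr_ge0 ?exprn_ge0 // ltW.
have := ler_wpM2l ct_ge0 (net_rate_le R (2 * d - 1) n_gt0).
by rewrite /c !mulrA; congr (_ <= _); ring.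
Qed.
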